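(* Let $B\subset A$ be an inclusion of simple unital $C^*$-algebras with a conditional expectation of index-finite type. For every $n\ge1$, the rotation operator $\rho_n^+:B'\cap A_n\to B'\cap A_n$ satisfies $(\rho_n^+)^{n+1}=\mathrm{id}_{B'\cap A_n}$.
   Context: Setting. $B\subset A$ is an inclusion of simple unital $C^*$-algebras (common unit) admitting a conditional expectation of index-finite type. A conditional expectation $E:A\to B$ is of index-finite type if it has a quasi-basis, i.e. a finite set $\{\lambda_1,\dots,\lambda_m\}\subset A$ with $x=\sum_i\lambda_iE(\lambda_i^*x)=\sum_iE(x\lambda_i)\lambda_i^*$ for all $x\in A$; its Watatani index is $\sum_i\lambda_i\lambda_i^*$ (a positive scalar here). $E_0:A\to B$ is the minimal conditional expectation (the unique one of smallest index), $[A:B]_0$ is its index, $\tau=[A:B]_0^{-1}$. Put $A_{-1}=B$, $A_0=A$; for $n\ge1$, $A_n$ is the $C^*$-basic construction of $A_{n-2}\subset A_{n-1}$ with respect to $E_{n-1}$, with Jones projection $e_n\in A_n$ (so $e_nxe_n=E_{n-1}(x)e_n$ for $x\in A_{n-1}$ and $A_n=\mathrm{span}\,A_{n-1}e_nA_{n-1}$), and $E_n:A_n\to A_{n-1}$ is the dual (minimal) conditional expectation, $E_n(xe_ny)=\tau xy$ for $x,y\in A_{n-1}$. For $C\subset D$, $C'\cap D=\{d\in D: dc=cd\ \forall c\in C\}$; the relative commutants $B'\cap A_n$ are finite-dimensional. $\mathrm{tr}$ is the faithful tracial state on $B'\cap A_n$ given by the restriction of $E_0\circ E_1\circ\cdots\circ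 E_n$. Fourier transform. $v_n=e_ne_{n-1}\cdots e_1$. $E^{B'\cap A_n}_{A'\cap A_n}$ is the $\mathrm{tr}$-preserving conditional expectation; $E^{B'\cap A_n}_{A'\cap A_n}(x)=\tau\sum_i\lambda_ix\lambda_i^*$ for any quasi-basis $\{\lambda_i\}$ of $E_0$. $\mathcal F_n:B'\cap A_n\to A'\cap A_{n+1}$, $\mathcal F_n(x)=\tau^{-\frac{n+2}{2}}E^{B'\cap A_{n+1}}_{A'\cap A_{n+1}}(xv_{n+1})$, a bijection with inverse $\mathcal F_n^{-1}(w)=\tau^{-\frac{n+2}{2}}E_{n+1}(wv_{n+1}^* )$. Rotation. $\rho_n^+(x)=\big(\mathcal F_n^{-1}(\mathcal F_n(x)^* )\big)^*$ for $x\in B'\cap A_n$. *)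

(* Defs.v *)
From HB Require Import structures.
From mathcomp Require Import all_boot all_order all_algebra.
From mathcomp Require Import complex.
From mathcomp Require Import all_classical all_reals all_analysis.
Set Implicit Arguments.
Unset Strict Implicit.
Unset Printing Implicit Defensive.
Import Order.TTheory GRing.Theory Num.Theory.
Import numFieldNormedType.Exports.
Local Open Scope classical_set_scope.
Local Open Scope complex_scope.
Local Open Scope ring_scope.

(* The norm is an ordinary function with values in R: the library's normed
   modules cannot be joined with its algebras, because the join of rings and
   normed groups is already taken by numDomainType. *)
HB.mixin Record isCStar (R : realType) M & GRing.Algebra R[i] M := {
  star : M -> M ;
  cnorm : M -> R ;
  starK : forall x, star (star x) = x ;
  starD : forall x y, star (x + y) = star x + star y ;
  starZ : forall (c : R[i]) x, star (c *: x) = c^* *: star x ;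
  starM : forall x y, star (x * y) = star y * star x ;
  cnorm_eq0 : forall x, cnorm x = 0 -> x = 0 ;
  cnorm_triangle : forall x y, cnorm (x + y) <= cnorm x + cnorm y ;
  cnormZ : forall (c : R[i]) x, cnorm (c *: x) = complex.Re `|c| * cnorm x ;
  cnormM : forall x y, cnorm (x * y) <= cnorm x * cnorm y ;
  cnorm_star : forall x, cnorm (star x * x) = cnorm x ^+ 2 ;
  cnorm_complete : forall u : nat -> M,
    (forall eps : R, 0 < eps -> exists N : nat, forall p q : nat,
       (N <= p)%N -> (N <= q)%N -> cnorm (u p - u q) < eps) ->
    exists x : M, (fun k => cnorm (u k - x)) @ \oo --> (0 : R)
}.

#[short(type="cstarType")]
HB.structure Definition CStar (R : realType) :=
  {M of isCStar R M & GRing.Algebra R[i] M}.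

Section CStarAlgebras.
Context {R : realType} {M : cstarType R}.
Implicit Types (B A D S J : set M) (E : M -> M) (x y : M).

Definition norm_closed S : Prop :=
  forall (u : nat -> M) x, (forall k, S (u k)) ->
    (fun k => cnorm (u k - x)) @ \oo --> (0 : R) -> S x.

Record subspace S : Prop := {
  subspace0 : S 0 ;
  subspaceD : forall x y, S x -> S y -> S (x + y) ;
  subspaceZ : forall (c : R[i]) x, S x -> S (c *: x)
}.

(* unital C*-subalgebra with the unit of the ambient algebra *)
Record cstar_subalg S : Prop := {
  subalg_subspace : subspace S ;
  subalg1 : S 1 ;
  subalgM : forall x y, S x -> S y -> S (x * y) ;
  subalg_star : forall x, S x -> S (star x) ;
  subalg_closed : norm_closed S
}.

Record closed_ideal S J : Prop := {
  ideal_sub : J `<=` S ;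
  ideal_subspace : subspace J ;
  idealMl : forall a x, S a -> J x -> J (a * x) ;
  idealMr : forall a x, S a -> J x -> J (x * a) ;
  ideal_closed : norm_closed J
}.

Definition simple_alg S : Prop :=
  forall J, closed_ideal S J -> J = [set 0] \/ J = S.

(* a positive element of a C*-algebra: the square of a self-adjoint one *)
Definition cpos x : Prop := exists2 h : M, star h = h & x = h * h.

Definition rel_commutant S D : set M :=
  [set d | D d /\ forall c, S c -> d * c = c * d].

(* E is a conditional expectation of A onto B; the values of E outside A are
   irrelevant. *)
Record cond_exp A B E : Prop := {
  ce_in : forall x, A x -> B (E x) ;
  ceD : forall x y, A x -> A y -> E (x + y) = E x + E y ;
  ceZ : forall (c : R[i]) x, A x -> E (c *: x) = c *: E x ;
  ce_id : forall b, B b -> E b = b ;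
  ce_bimod : forall b x b', B b -> A x -> B b' -> E (b * x * b') = b * E x * b' ;
  ce_pos : forall x, A x -> cpos (E (star x * x))
}.

Record quasi_basis A E (s : seq M) : Prop := {
  qb_in : forall l, l \in s -> A l ;
  qb_left : forall x, A x -> x = \sum_(l <- s) l * E (star l * x) ;
  qb_right : forall x, A x -> x = \sum_(l <- s) E (x * l) * star l
}.

Definition index_finite_type A B E : Prop :=
  cond_exp A B E /\ exists s, quasi_basis A E s.

(* w is the Watatani index of E. *)
Definition watatani_index A E w : Prop :=
  exists2 s, quasi_basis A E s & w = \sum_(l <- s) l * star l.

(* E is the conditional expectation A -> B of smallest index w. *)
Definition minimal_cond_exp A B E w : Prop :=
  [/\ cond_exp A B E, watatani_index A E w &
      forall E' w', cond_exp A B E' -> watatani_index A E' w' -> cpos (w' - w)].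

(* D, with Jones projection e, is the C*-basic construction of an
   inclusion in A with respect to a conditional expectation E of A.  The right Hilbert module is A itself (complete, as E has a
   quasi-basis) with inner product <x, y> = E (x^* y), and D is identified,
   through pi, with the span of the operators lambda(x) e_B lambda(y), where
   lambda is left multiplication and e_B is x |-> E x.  The last field of
   basic_rep says that pi (star d) is the adjoint of pi d. *)
Record basic_rep A D E (e : M) (pi : M -> M -> M) : Prop := {
  rep_in : forall d x, D d -> A x -> A (pi d x) ;
  repD : forall d d' x, D d -> D d' -> A x -> pi (d + d') x = pi d x + pi d' x ;
  repZ : forall (c : R[i]) d x, D d -> A x -> pi (c *: d) x = c *: pi d x ;
  repM : forall d d' x, D d -> D d' -> A x -> pi (d * d') x = pi d (pi d' x) ;
  rep_inj : forall d, D d -> (forall x, A x -> pi d x = 0) -> d = 0 ;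
  rep_mul : forall a x, A a -> A x -> pi a x = a * x ;
  rep_jones : forall x, A x -> pi e x = E x ;
  rep_adj : forall d x y, D d -> A x -> A y ->
    E (star (pi d x) * y) = E (star x * pi (star d) y)
}.

Record basic_construction A D E (e : M) : Prop := {
  bc_subalg : cstar_subalg D ;
  bc_sub : A `<=` D ;
  bc_jones : D e ;
  bc_span : forall d, D d <-> exists2 s : seq (M * M),
      (forall p, p \in s -> A p.1 /\ A p.2) & d = \sum_(p <- s) p.1 * e * p.2 ;
  bc_rep : exists pi, basic_rep A D E e pi
}.

(* The tower B = A_{-1}, A = A_0, A_1, ..., all inside one ambient
   C*-algebra (for instance the inductive limit).  Here tw_alg n = A_n for
   n >= 0, tw_exp n = E_n : A_n -> A_{n-1}, tw_jones n = e_n for n >= 1 (the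
   value of tw_jones 0 is irrelevant), and tw_tau = [A:B]_0^{-1}. *)
Record jones_tower B A := {
  tw_alg : nat -> set M ;
  tw_exp : nat -> M -> M ;
  tw_jones : nat -> M ;
  tw_tau : R ;
  tw_alg0 : tw_alg 0 = A ;
  tw_tau_gt0 : 0 < tw_tau ;
  tw_minimal : minimal_cond_exp A B (tw_exp 0) ((tw_tau^-1)%:C *: 1) ;
  tw_basic : forall n,
    basic_construction (tw_alg n) (tw_alg n.+1) (tw_exp n) (tw_jones n.+1) ;
  tw_cond_exp : forall n, cond_exp (tw_alg n.+1) (tw_alg n) (tw_exp n.+1) ;
  tw_dual : forall n x y, tw_alg n x -> tw_alg n y ->
    tw_exp n.+1 (x * tw_jones n.+1 * y) = tw_tau%:C *: (x * y)
}.

Section Rotation.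
Variables (B A : set M) (T : jones_tower B A).
Local Notation tau := (tw_tau T).
Local Notation E := (tw_exp T).

Definition rcB (n : nat) : set M := rel_commutant B (tw_alg T n).
Definition rcA (n : nat) : set M := rel_commutant A (tw_alg T n).

(* E_0 o E_1 o ... o E_n; on the relative commutant
   of B in A_n its values are scalar multiples of 1. *)
Fixpoint tr (n : nat) (x : M) : M :=
  if n is m.+1 then tr m (E n x) else E 0 x.

Definition tr_preserving_cond_exp (n : nat) (F : M -> M) : Prop :=
  cond_exp (rcB n) (rcA n) F /\ forall x, rcB n x -> tr n (F x) = tr n x.

(* v_n = e_n e_{n-1} ... e_1 *)
Fixpoint vprod (n : nat) : M :=
  if n is m.+1 then tw_jones T n * vprod m else 1.

(* In what follows EE n is the tr-preserving expectation rcB n -> rcA n. *)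
Definition fourier (EE : nat -> M -> M) (n : nat) (x : M) : M :=
  (tau `^ (- (n.+2%:R / 2)))%:C *: EE n.+1 (x * vprod n.+1).

(* the inverse of the bijection fourier EE n : rcB n -> rcA n.+1 *)
Definition fourier_inv (EE : nat -> M -> M) (n : nat) (w : M) : M :=
  xget 0 [set x | rcB n x /\ fourier EE n x = w].

Definition rotation (EE : nat -> M -> M) (n : nat) (x : M) : M :=
  star (fourier_inv EE n (star (fourier EE n x))).

End Rotation.
End CStarAlgebras.

(* Main.v *)
(* A variational argument turns minimality of E_0 into E_0(x) = tau sum_i l_i x l_i^*
   on B' in A (this uses that the centre of the simple algebra B is trivial).
   This spherical identity passes to the dual expectation of a basic
   construction and to composites, hence to tr = E_0 ... E_n, and it forces
   tr(x y) = tr(y x) for x in B' in A_n and all y in A_n.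

   With v_n = e_n ... e_1, uniqueness of the trace-preserving expectation and
   the quasi-basis tau^(-n/2) l_i v_n^* of E_n give
     rho(x) = tau^(-n) sum_i E_n(v_n l_i x) v_n l_i^*.
   Unwinding n + 1 iterates yields
     rho^(n+1)(x) = c sum_l tr(U_l x) W_l,
   where U_l and W_l are words in the l_i and the v_j, whereas iterating the
   quasi-basis expansion yields x = c sum_l tr(x U_l) W_l. *)

Require Import Defs.
From HB Require Import structures.
From mathcomp Require Import all_boot all_order all_algebra.
From mathcomp Require Import complex.
From mathcomp Require Import all_classical all_reals all_analysis.
From mathcomp Require Import ring lra.
Import Order.TTheory GRing.Theory Num.Theory.
Import numFieldNormedType.Exports.
Local Open Scope classical_set_scope.
Local Open Scope ring_scope.

Set Implicit Arguments.
Unset Strict Implicit.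
Unset Printing Implicit Defensive.

(** * Norm and adjoint *)

Section Basics.
Context {R : realType} {M : cstarType R}.
Implicit Types (A B D S : set M) (E : M -> M) (x y z a b c d h : M) (r : R).

(** All the C*-theory below rests on one square-root iteration inside a closed subalgebra.
    Positivity of a self-adjoint a becomes a norm condition, norm (r - a) <= r, and roots that must
    commute are taken inside commutants; spectra never appear. The exponent n + 1 counts
    expectations: every rotation lowers x by one of E_n, ..., E_0 and raises the result again, so n
    + 1 rotations lower x all the way to B. The words U_l contain letters l_i that need not commute
    with B. A trace property on the relative commutant alone would therefore not compare tr(U_l x)
    with tr(x U_l); this is why tr is treated as a B-valued expectation and why its trace identity
    allows y in all of A_n. That the same U_l occurs in both sums is not automatic: rotating
    produces v_0 l_0 v_1 l_1 ..., expanding produces products of l_i and adjoints of v_j. They agree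
    because e_i commutes with A_(i-2), which lets the projections be regrouped. *)

Lemma star_real r x : star (r%:C%C *: x) = r%:C%C *: star x.
Proof. by rewrite starZ; congr (_ *: _); exact: conjc_real. Qed.

Lemma star0 : star (0 : M) = 0.
Proof. by rewrite -(scale0r (0 : M)) starZ (_ : 0^* = 0) ?scale0r // conjC0. Qed.

Lemma starN x : star (- x) = - star x.
Proof. by apply/eqP; rewrite -addr_eq0 -starD addNr star0. Qed.

Lemma starB x y : star (x - y) = star x - star y.
Proof. by rewrite starD starN. Qed.

Lemma star1 : star (1 : M) = 1.
Proof. by have := starM (star (1 : M)) 1; rewrite mulr1 starK mulr1. Qed.

Lemma cnormZr r x : cnorm (r%:C%C *: x) = `|r| * cnorm x.
Proof. by rewrite cnormZ normc_def /= expr0n /= addr0 sqrtr_sqr. Qed.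

Lemma cnorm0 : cnorm (0 : M) = 0.
Proof. by rewrite -(scale0r (0 : M)) (cnormZr 0) normr0 mul0r. Qed.

Lemma scaleN1c x : (-1)%:C%C *: x = - x.
Proof. by rewrite rmorphN rmorph1 scaleN1r. Qed.

Lemma cnormN x : cnorm (- x) = cnorm x.
Proof. by rewrite -scaleN1c cnormZr normrN1 mul1r. Qed.

Lemma cnorm_distC x y : cnorm (x - y) = cnorm (y - x).
Proof. by rewrite -opprB cnormN. Qed.

Lemma cnorm_ge0 x : 0 <= cnorm x.
Proof.
have := cnorm_triangle x (- x); rewrite subrr cnorm0 cnormN -mulr2n.
by rewrite pmulrn_lge0.
Qed.
#[local] Hint Resolve cnorm_ge0 : core.

Lemma cnorm_adj x : cnorm (star x) = cnorm x.
Proof.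
suff le y : cnorm y <= cnorm (star y).
  by apply/le_anti; rewrite le andbT -{2}(starK x).
have [->//|] := eqVneq (cnorm y) 0.
move=> y0.
have yp : 0 < cnorm y by rewrite lt_neqAle eq_sym y0 cnorm_ge0.
by rewrite -(ler_pM2r yp) -expr2 -cnorm_star cnormM.
Qed.

Lemma cnorm1_le1 : cnorm (1 : M) <= 1.
Proof.
have := cnorm_star (1 : M); rewrite star1 mulr1 => h.
have := cnorm_ge0 (1 : M); nra.
Qed.

Lemma cnorm_sqr h : star h = h -> cnorm (h * h) = cnorm h ^+ 2.
Proof. by move=> hh; rewrite -cnorm_star hh. Qed.

Lemma eq0_small x (C : R) : (forall e, 0 < e -> cnorm x <= C * e) -> x = 0.
Proof.
move=> H; apply: cnorm_eq0; apply/le_anti; rewrite cnorm_ge0 andbT.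
rewrite leNgt; apply/negP => x0.
have C0 : 0 < C by have := H 1 ltr01; rewrite mulr1; apply: lt_le_trans.
have e0 : 0 < cnorm x / (2 * C) by rewrite divr_gt0 // mulr_gt0.
have := H _ e0; rewrite (_ : C * _ = cnorm x / 2); last by field; lra.
lra.
Qed.

Lemma cvg0P (u : nat -> M) x :
  (fun k => cnorm (u k - x)) @ \oo --> (0 : R) <->
  forall e : R, 0 < e -> exists N, forall k, (N <= k)%N -> cnorm (u k - x) < e.
Proof.
split=> [/cvgrPdist_lt H e e0|H].
  have [N _ HN] := H e e0; exists N => k Nk.
  by have := HN k Nk; rewrite /= sub0r normrN ger0_norm.
apply/cvgrPdist_lt => e e0; have [N HN] := H e e0.
by exists N => // k Nk /=; rewrite sub0r normrN ger0_norm // HN.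
Qed.

(** Majorant method: [r] is nondecreasing and bounded, and once it is within e of its supremum
    neither [r] nor [u] can move by e again. *)
Lemma dominated_increments_cvg (u : nat -> M) (r : nat -> R) (C : R) :
  (forall k, cnorm (u k.+1 - u k) <= r k.+1 - r k) -> (forall k, r k <= C) ->
  exists x, (fun k => cnorm (u k - x)) @ \oo --> (0 : R).
Proof.
move=> ur rC; apply: cnorm_complete => e e0.
have dist p k : cnorm (u (p + k)%N - u p) <= r (p + k)%N - r p.
  elim: k => [|k IH]; first by rewrite addn0 !subrr cnorm0.
  rewrite addnS -(subrKA (u (p + k)%N)); apply: le_trans (cnorm_triangle _ _) _.
  by have := ur (p + k)%N; lra.
have rmono p k : (p <= k)%N -> r p <= r k.
  by move=> /subnKC <-; rewrite -subr_ge0; apply: le_trans (dist _ _).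
have hs : has_sup (range r).
  by split; [exists (r 0%N), 0%N | exists C => _ [k _ <-]].
have [_ [N _ <-] HN] := sup_adherent e0 hs.
have Hd p q : (N <= p)%N -> (p <= q)%N -> cnorm (u q - u p) < e.
  move=> Np pq; rewrite -(subnKC pq); apply: le_lt_trans (dist _ _) _.
  rewrite subnKC //; have := rmono _ _ Np.
  have : r q <= sup (range r) by apply: ub_le_sup; [case: hs | exists q].
  lra.
exists N => p q Np Nq; case: (leqP p q) => pq; first by rewrite cnorm_distC Hd.
by rewrite Hd // ltnW.
Qed.

Lemma subalgD S : cstar_subalg S -> forall x y, S x -> S y -> S (x + y).
Proof. by move=> hS; apply: subspaceD (subalg_subspace hS). Qed.

Lemma subalgZ S : cstar_subalg S -> forall k x, S x -> S (k *: x).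
Proof. by move=> hS; apply: subspaceZ (subalg_subspace hS). Qed.

Lemma subalg0 S : cstar_subalg S -> S 0.
Proof. by move=> hS; apply: subspace0 (subalg_subspace hS). Qed.

Lemma subalgN S : cstar_subalg S -> forall x, S x -> S (- x).
Proof. by move=> hS x Sx; rewrite -scaleN1r; apply: subalgZ. Qed.

Lemma subalgB S : cstar_subalg S -> forall x y, S x -> S y -> S (x - y).
Proof. by move=> hS x y Sx Sy; apply: subalgD => //; apply: subalgN. Qed.

Lemma subalg_sum S (I : eqType) (s : seq I) (F : I -> M) : cstar_subalg S ->
  (forall i, i \in s -> S (F i)) -> S (\sum_(i <- s) F i).
Proof.
move=> hS HF; rewrite big_seq; apply: big_ind => //; first exact: subalg0.
exact: subalgD.
Qed.

Lemma cstar_subalgT : cstar_subalg (@setT M).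
Proof. by split. Qed.

Lemma comm_norm_closed c (u : nat -> M) x :
  (forall k, u k * c = c * u k) ->
  (fun k => cnorm (u k - x)) @ \oo --> (0 : R) -> x * c = c * x.
Proof.
move=> uc /cvg0P ux; apply/eqP; rewrite -subr_eq0; apply/eqP.
apply: (@eq0_small _ (2 * cnorm c)) => e e0.
have [N HN] := ux e e0; have {HN} := HN N (leqnn _).
have -> : x * c - c * x = c * (u N - x) - (u N - x) * c.
  by rewrite mulrBr mulrBl uc opprB [RHS]addrC addrA subrK.
have := cnorm_triangle (c * (u N - x)) (- ((u N - x) * c)); rewrite cnormN.
have := cnormM c (u N - x); have := cnormM (u N - x) c.
have := cnorm_ge0 c; have := cnorm_ge0 (u N - x); nra.
Qed.

(** Square roots are later taken inside such commutants, which makes them commute with prescribed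
    elements. *)
Lemma cstar_subalg_commutant S D : cstar_subalg D ->
  (forall c, S c -> S (star c)) -> cstar_subalg (rel_commutant S D).
Proof.
move=> hD Sstar; split.
- split; first by split=> [|c _]; [exact: subalg0 | rewrite mul0r mulr0].
  + move=> x y [Dx xS] [Dy yS]; split; first exact: subalgD.
    by move=> c Sc; rewrite mulrDl mulrDr xS ?yS.
  + move=> k x [Dx xS]; split; first exact: subalgZ.
    by move=> c Sc; rewrite -scalerAl -scalerAr xS.
- by split=> [|c _]; [exact: subalg1 | rewrite mul1r mulr1].
- move=> x y [Dx xS] [Dy yS]; split; first exact: subalgM.
  by move=> c Sc; rewrite -mulrA yS // !mulrA xS.
- move=> x [Dx xS]; split; first exact: subalg_star.
  by move=> c Sc; rewrite -(starK c) -!starM xS //; apply: Sstar.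
- move=> u x uS ux; split.
    by have cl := Defs.subalg_closed hD; apply: (cl u) ux => k; case: (uS k).
  by move=> c Sc; apply: comm_norm_closed ux => k; case: (uS k) => _; apply.
Qed.

End Basics.
#[global] Hint Resolve cnorm_ge0 : core.

(** * Square roots and positive elements *)

Section Positivity.
Context {R : realType} {M : cstarType R}.
Implicit Types (A B D S : set M) (E : M -> M) (x y z a b c d h p : M) (r s t : R).

Lemma cnormB_le x y z : cnorm (x - z) <= cnorm (x - y) + cnorm (y - z).
Proof. by rewrite -(subrKA y x (- z)) cnorm_triangle. Qed.

Lemma cnorm_le_limit (u : nat -> M) x r : (forall k, cnorm (u k) <= r) ->
  (fun k => cnorm (u k - x)) @ \oo --> (0 : R) -> cnorm x <= r.
Proof.
move=> ur /cvg0P ux; rewrite leNgt; apply/negP => rx.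
have [N /(_ N (leqnn _))] := ux (cnorm x - r) ltac:(lra).
have := cnormB_le x (u N) 0; rewrite !subr0 cnorm_distC; have := ur N; lra.
Qed.

Lemma scale_half2 x : 2^-1%:C%C *: (x + x) = x.
Proof.
rewrite scalerDr -scalerDl -rmorphD (_ : 2^-1 + 2^-1 = 1) ?rmorph1 ?scale1r //; lra.
Qed.

(* Fixed-point iteration b = (c + b^2) / 2 for b = 1 - sqrt (1 - c); its
   increments are dominated by those of the scalar iteration with c = 1, so no
   strict inequality is needed. *)
Lemma sqrt_one_sub S c : cstar_subalg S -> S c -> cnorm c <= 1 ->
  exists d, [/\ S d, d * d = 1 - c, cnorm (1 - d) <= 1 & star c = c -> star d = d].
Proof.
move=> hS Sc c1.
pose H := (2^-1 : R).
pose b := fix b k : M := if k is j.+1 then H%:C%C *: (c + b j * b j) else 0.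
pose r := fix r k : R := if k is j.+1 then (1 + r j ^+ 2) / 2 else 0.
have r01 k : 0 <= r k <= 1.
  elim: k => [|k IH] /=; first by rewrite lexx ler01.
  by move: IH => /andP[]; set u := r k; nra.
have H0 : `|H| = H by rewrite ger0_norm // invr_ge0.
have HE : H = 1 / 2 by rewrite mul1r.
have bc y k : y * c = c * y -> y * b k = b k * y.
  move=> yc; elim: k => [|k IH] /=; first by rewrite mulr0 mul0r.
  by rewrite -scalerAr -scalerAl mulrDl mulrDr yc mulrA IH -!mulrA IH.
have bb j k : b j * b k = b k * b j.
  by apply: (bc (b j)); apply: esym; apply: bc.
have nb k : cnorm (b k) <= r k.
  elim: k => [|k IH] /=; first by rewrite cnorm0.
  rewrite cnormZr H0 HE; have := cnorm_triangle c (b k * b k).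
  have := cnormM (b k) (b k); have := cnorm_ge0 (b k); nra.
have incr k : cnorm (b k.+1 - b k) <= r k.+1 - r k.
  elim: k => [|k IH] /=.
    by rewrite mulr0 addr0 subr0 cnormZr H0 HE expr0n /=; lra.
  have -> : H%:C%C *: (c + b k.+1 * b k.+1) - H%:C%C *: (c + b k * b k) =
            H%:C%C *: ((b k.+1 - b k) * (b k.+1 + b k)).
    rewrite -scalerBr; congr (_ *: _).
    by rewrite opprD addrACA subrr add0r mulrBl !mulrDr (bb k.+1 k) opprD addrA addrK.
  rewrite cnormZr H0 HE; have := cnormM (b k.+1 - b k) (b k.+1 + b k).
  have := cnorm_triangle (b k.+1) (b k); have := nb k; have := nb k.+1.
  have := cnorm_ge0 (b k.+1 - b k); have := cnorm_ge0 (b k.+1 + b k).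
  move: IH; rewrite /=; set u := r k; set v := (1 + u ^+ 2) / 2.
  move: (r01 k) => /andP[]; rewrite -/u; set P := cnorm (_ * _).
  set X := cnorm (_ - _); set Y := cnorm (_ + _) => u0 u1 XI Y0 X0 nv nu YI PXY.
  have : X * Y <= (v - u) * (v + u) by apply: ler_pM => //; lra.
  have vE : 2 * v = 1 + u ^+ 2 by rewrite /v; lra.
  by lra.
have [x bx] := dominated_increments_cvg incr (fun k => proj2 (andP (r01 k))).
have Sb k : S (b k).
  elim: k => [|k IH] /=; first exact: subalg0.
  by apply: subalgZ => //; apply: subalgD => //; apply: subalgM.
have x1 : cnorm x <= 1.
  by apply: cnorm_le_limit bx => k; apply: le_trans (nb k) (proj2 (andP (r01 k))).
have bx' := (cvg0P _ _).1 bx.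
have xE : x = H%:C%C *: (c + x * x).
  apply/eqP; rewrite -subr_eq0; apply/eqP; apply: (@eq0_small _ _ _ 2) => e e0.
  have [N HN] := bx' e e0.
  have := HN N (leqnn _); have := HN N.+1 (leqnSn _).
  have := cnormB_le x (b N.+1) (H%:C%C *: (c + x * x)); rewrite cnorm_distC.
  have -> : b N.+1 - H%:C%C *: (c + x * x) =
            H%:C%C *: (c + b N * b N - (c + x * x)) by rewrite scalerBr.
  rewrite [X in _ <= _ + X]cnormZr H0.
  have -> : c + b N * b N - (c + x * x) = b N * (b N - x) + (b N - x) * x.
    by rewrite opprD addrACA subrr add0r mulrBr mulrBl addrA subrK.
  have := cnorm_triangle (b N * (b N - x)) ((b N - x) * x).
  have := cnormM (b N) (b N - x); have := cnormM (b N - x) x.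
  have := nb N; move: (r01 N) => /andP[].
  have := cnorm_ge0 (b N - x); have := cnorm_ge0 x; have := cnorm_ge0 (b N).
  set X := cnorm (b N - x); set Y := cnorm x; set Z := cnorm (b N).
  move=> Z0 Y0 X0 r0 r1 Zr YX ZX T L2 L1 Le.
  have := ler_piMr X0 x1; have := ler_piMl X0 (le_trans Zr r1).
  by move: L2; rewrite -/Y [cnorm (x - _)]cnorm_distC [H * _](congr1 ( *%R^~ _) HE); lra.
exists (1 - x); split.
- apply: subalgB => //; first exact: subalg1.
  have cl := Defs.subalg_closed hS; exact: (cl b).
- rewrite mulrBr mulr1 mulrBl mul1r.
  have -> : x * x = x + x - c.
    by rewrite {3 4}xE -scalerDr scale_half2 addrC addKr.
  by rewrite opprB (addrAC _ (- c)) addrK addrA subrK.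
- by rewrite subKr.
- move=> cs; have bs k : star (b k) = b k.
    elim: k => [|k IH] /=; first exact: star0.
    by rewrite star_real starD starM cs IH.
  rewrite starB star1; congr (_ - _); apply/eqP; rewrite -subr_eq0; apply/eqP.
  apply: (@eq0_small _ _ _ 2) => e e0; have [N /(_ N (leqnn _)) HN] := bx' e e0.
  have := cnormB_le (star x) (b N) x; rewrite -{1}(bs N) -starB cnorm_adj.
  by rewrite [cnorm (x - b N)]cnorm_distC; lra.
Qed.

Lemma star_cartesian x y : star x = x -> star y = y ->
  star (x + 'i%C *: y) = x - 'i%C *: y.
Proof.
by move=> sx sy; rewrite starD starZ sx sy -scaleNr; congr (_ + _ *: _); simpc.
Qed.

Lemma cartesian_sqr x y : star x = x -> star y = y -> y * x = x * y ->
  star (x + 'i%C *: y) * (x + 'i%C *: y) = x * x + y * y.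
Proof.
move=> sx sy yx; rewrite star_cartesian // mulrBl !mulrDr -!scalerAl -!scalerAr.
rewrite yx scalerA (_ : 'i%C * 'i%C = -1); last by rewrite -expr2 sqr_i.
by rewrite opprD addrA addrK scaleN1r opprK.
Qed.

(** With b the root of 1 - h^2 commuting with h, the element h + i b satisfies |h + i b|^2 = 1, so
    its norm is at most 1. As b is its imaginary part, b has norm at most 1 too, and b^2 = 1 -
    h^2. *)
Lemma sqr_bound h : star h = h -> cnorm h <= 1 -> cnorm (1 - h * h) <= 1.
Proof.
move=> hh h1; pose S := rel_commutant [set h] (@setT M).
have hS : cstar_subalg S.
  by apply: cstar_subalg_commutant (cstar_subalgT) _ => c ->; rewrite hh.
have Sh : S (h * h) by split=> // c ->; rewrite mulrA.
have h2 : cnorm (h * h) <= 1.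
  by rewrite cnorm_sqr //; have := cnorm_ge0 h; nra.
have [b [[_ bh] bb _ bs]] := sqrt_one_sub hS Sh h2.
have {bh} bh : b * h = h * b by apply: bh.
have {bs} bs : star b = b by apply: bs; rewrite starM hh.
have u1 : cnorm (h + 'i%C *: b) <= 1.
  have := cnorm_star (h + 'i%C *: b); rewrite cartesian_sqr // bb addrC subrK.
  by have := cnorm_ge0 (h + 'i%C *: b); have := cnorm1_le1 (M := M); nra.
have b1 : cnorm (b + b) <= 2.
  have -> : b + b = - 'i%C *: ((h + 'i%C *: b) - star (h + 'i%C *: b)).
    rewrite star_cartesian // opprB [h + _]addrC addrACA subrr addr0 -scalerDr scalerA.
    by rewrite mulNr -expr2 sqr_i opprK scale1r.
  rewrite scaleNr cnormN cnormZ normc_def /= expr0n expr1n add0r sqrtr1 mul1r.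
  have := cnorm_triangle (h + 'i%C *: b) (- star (h + 'i%C *: b)).
  by rewrite cnormN cnorm_adj; lra.
have {}b1 : cnorm b <= 1.
  by rewrite -(scale_half2 b) cnormZr ger0_norm ?invr_ge0 //; lra.
by rewrite -bb cnorm_sqr //; have := cnorm_ge0 b; nra.
Qed.

Lemma rescale_ball r a : 0 < r ->
  (cnorm (1 - r^-1%:C%C *: a) <= 1) = (cnorm (r%:C%C *: 1 - a) <= r).
Proof.
move=> r0; have -> : 1 - r^-1%:C%C *: a = r^-1%:C%C *: (r%:C%C *: 1 - a).
  by rewrite scalerBr scalerA -rmorphM mulVf ?gt_eqF // rmorph1 scale1r.
by rewrite cnormZr ger0_norm ?invr_ge0 ?(ltW r0) // ler_pdivrMl // mulr1.
Qed.

(** After rescaling [r] to 1, the root [d] again lies within distance 1 of the unit, so the same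
    construction yields a self-adjoint root [g] of [d]. This second root is what makes [h] positive
    and not merely self-adjoint. *)
Lemma sqrt_in_subalg S a r : cstar_subalg S -> S a -> star a = a ->
  cnorm (r%:C%C *: 1 - a) <= r -> exists h, [/\ S h, star h = h, cpos h & a = h * h].
Proof.
move=> hS Sa sa ar; have r0 : 0 <= r by apply: le_trans ar; exact: cnorm_ge0.
have unit_case S' a' : cstar_subalg S' -> S' a' -> star a' = a' -> cnorm (1 - a') <= 1 ->
    exists d, [/\ S' d, d * d = a', cnorm (1 - d) <= 1 & star d = d].
  move=> hS' Sa' sa' a1; have S1 : S' (1 - a') by apply: subalgB => //; exact: subalg1.
  have [d [Sd dd d1 ds]] := sqrt_one_sub hS' S1 a1.
  by exists d; split=> //; [rewrite dd subKr | apply: ds; rewrite starB star1 sa'].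
move: r0; rewrite le_eqVlt => /orP[/eqP r0|r0].
  move: ar; rewrite -r0 scale0r sub0r cnormN => a0.
  have {}a0 : a = 0 by apply: cnorm_eq0; apply/le_anti; rewrite a0 cnorm_ge0.
  exists 0; split; [exact: subalg0 | exact: star0 | | by rewrite mulr0].
  by exists 0; [exact: star0 | rewrite mulr0].
have rs0 : 0 <= Num.sqrt r by apply: sqrtr_ge0.
have rr : r = Num.sqrt r * Num.sqrt r by rewrite -expr2 sqr_sqrtr // (ltW r0).
rewrite -rescale_ball // in ar.
have [d [Sd dd d1 ds]] := unit_case S _ hS (subalgZ hS r^-1%:C%C Sa)
  ltac:(by rewrite star_real sa) ar.
have [g [Sg gg g1 gs]] := unit_case S _ hS Sd ds d1.
exists ((Num.sqrt r)%:C%C *: d); split; first exact: subalgZ.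
- by rewrite star_real ds.
- exists ((Num.sqrt (Num.sqrt r))%:C%C *: g); first by rewrite star_real gs.
  by rewrite -scalerAl -scalerAr gg scalerA -rmorphM -expr2 sqr_sqrtr.
- rewrite -scalerAl -scalerAr dd !scalerA -!rmorphM -rr divff ?gt_eqF //.
  by rewrite rmorph1 scale1r.
Qed.

Lemma cpos_star a : cpos a -> star a = a.
Proof. by case=> h hh ->; rewrite starM hh. Qed.

(** Rescaling reduces this to [sqr_bound]. Together with [cposP] it turns positivity of a
    self-adjoint element into a norm condition, which passes to limits. *)
Lemma cpos_ball a r : cpos a -> cnorm a <= r -> cnorm (r%:C%C *: 1 - a) <= r.
Proof.
move=> [h hh ->] hr; have r0 : 0 <= r by apply: le_trans hr; exact: cnorm_ge0.
move: r0; rewrite le_eqVlt => /orP[/eqP r0|r0].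
  by move: hr; rewrite -r0 scale0r sub0r cnormN.
have rs0 : 0 < Num.sqrt r by rewrite sqrtr_gt0.
have rr : r = Num.sqrt r * Num.sqrt r by rewrite -expr2 sqr_sqrtr // (ltW r0).
rewrite -rescale_ball //.
have -> : r^-1%:C%C *: (h * h) =
    ((Num.sqrt r)^-1%:C%C *: h) * ((Num.sqrt r)^-1%:C%C *: h).
  by rewrite -scalerAl -scalerAr scalerA -rmorphM {1}rr invfM.
apply: sqr_bound; first by rewrite star_real hh.
rewrite cnormZr ger0_norm ?invr_ge0 ?(ltW rs0) // ler_pdivrMl // mulr1.
move: hr; rewrite cnorm_sqr // {1}rr -expr2 ler_pXn2r // ?nnegrE ?(ltW rs0) //.
exact: cnorm_ge0.
Qed.

Lemma cposP a r : star a = a -> cnorm (r%:C%C *: 1 - a) <= r -> cpos a.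
Proof.
move=> sa ar; have [h [_ hh _ ->]] := sqrt_in_subalg cstar_subalgT I sa ar.
by exists h.
Qed.

Lemma cpos_sqrt S a : cstar_subalg S -> S a -> cpos a ->
  exists h, [/\ S h, star h = h, cpos h & a = h * h].
Proof.
move=> hS Sa pa; apply: (sqrt_in_subalg hS Sa (cpos_star pa)).
exact: cpos_ball pa (lexx _).
Qed.

Lemma cposZ r a : 0 <= r -> cpos a -> cpos (r%:C%C *: a).
Proof.
move=> r0 [h hh ->]; exists ((Num.sqrt r)%:C%C *: h); first by rewrite star_real hh.
by rewrite -scalerAl -scalerAr scalerA -rmorphM -(expr2 (Num.sqrt r)) sqr_sqrtr.
Qed.

Lemma cpos_closed a : (forall e : R, 0 < e -> exists2 a', cpos a' & cnorm (a - a') <= e) ->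
  cpos a.
Proof.
move=> H; apply: (@cposP _ (cnorm a)).
  apply/eqP; rewrite -subr_eq0; apply/eqP; apply: (@eq0_small _ _ _ 2) => e e0.
  have [a' pa' aa'] := H e e0; have := cnormB_le (star a) a' a.
  by rewrite -{1}(cpos_star pa') -starB cnorm_adj [cnorm (a' - a)]cnorm_distC; lra.
rewrite leNgt; apply/negP => lt0; set d := cnorm (_ - _) in lt0.
(* The approximation error enters the estimate of d twice and the slack r - cnorm a is of the same
   size; a quarter of the gap for each uses only three quarters of it. *)
have [a' pa' aa'] := H ((d - cnorm a) / 4) ltac:(lra).
pose r := cnorm a + (d - cnorm a) / 4.
have ar : cnorm a' <= r.
  by have := cnormB_le a' a 0; rewrite !subr0 cnorm_distC /r; lra.
have := cpos_ball pa' ar.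
have : d <= (r - cnorm a) + cnorm (r%:C%C *: 1 - a') + cnorm (a - a').
  have r0 : 0 <= r - cnorm a by rewrite /r; lra.
  rewrite /d (_ : _ - a = ((cnorm a)%:C%C *: 1 - r%:C%C *: 1) +
     (r%:C%C *: 1 - a') - (a - a')); last first.
    by rewrite subrKA opprB addrA subrK.
  apply: le_trans (cnorm_triangle _ _) _; rewrite cnormN lerD2r.
  apply: le_trans (cnorm_triangle _ _) _; rewrite lerD2r.
  rewrite -scalerBl -rmorphB cnormZr distrC ger0_norm //.
  by have := cnorm1_le1 (M := M); have := cnorm_ge0 (1 : M); nra.
rewrite /r; lra.
Qed.

(** The root d of a commutes with a, and the root e of -a is chosen to commute with d. Then |d + i
    e|^2 = a - a = 0, so the self-adjoint part d vanishes. *)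
Lemma cpos_antisym a : cpos a -> cpos (- a) -> a = 0.
Proof.
move=> pa pna; have sa := cpos_star pa.
pose S1 := rel_commutant [set a] (@setT M).
have hS1 : cstar_subalg S1.
  by apply: cstar_subalg_commutant cstar_subalgT _ => c ->.
have S1a : S1 a by split=> // c ->.
have [d [[_ da] ds pd add]] := cpos_sqrt hS1 S1a pa.
have {}da : d * a = a * d by apply: da.
pose S2 := rel_commutant [set d] (@setT M).
have hS2 : cstar_subalg S2.
  by apply: cstar_subalg_commutant cstar_subalgT _ => c ->.
have S2a : S2 (- a) by split=> // c ->; rewrite mulrN mulNr da.
have [e [[_ ed] es pe aee]] := cpos_sqrt hS2 S2a pna.
have {}ed : e * d = d * e by apply: ed.
have u0 : d + 'i%C *: e = 0.
  apply: cnorm_eq0; apply/eqP; rewrite -sqrf_eq0 -cnorm_star cartesian_sqr //.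
  by rewrite -add -aee subrr cnorm0.
have v0 : d - 'i%C *: e = 0 by rewrite -star_cartesian // u0 star0.
have : d + d = 0.
  have := congr2 +%R u0 v0; rewrite addrACA subrr !addr0.
  done.
move=> /(congr1 (fun x => 2^-1%:C%C *: x)); rewrite scale_half2 scaler0 => d0.
by rewrite add d0 mulr0.
Qed.

End Positivity.

(** * The centre of a simple algebra *)

Section SimpleCenter.
Context {R : realType} {M : cstarType R}.
Implicit Types (A B D S : set M) (E : M -> M) (x y z a b c d h p : M) (r s t : R).

(* For h = |z| the annihilator of h + z is an ideal containing h - z. *)
Lemma simple_central_sign B z : cstar_subalg B -> simple_alg B ->
  rel_commutant B B z -> star z = z -> cpos z \/ cpos (- z).
Proof.
move=> hB sB Zz sz; pose Z := rel_commutant B B.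
have hZ : cstar_subalg Z.
  by apply: cstar_subalg_commutant => // c; apply: subalg_star.
have pz : cpos (z * z) by exists z.
have [h [Zh sh ph zz]] := cpos_sqrt hZ (subalgM hZ Zz Zz) pz.
have [Bhz hzC] : Z (h + z) by apply: subalgD.
have Bhz' : B (h - z) by apply: subalgB => //; [case: Zh | case: Zz].
have hz0 : (h + z) * (h - z) = 0.
  by rewrite mulrDl !mulrBr zz (Zz.2 _ Zh.1) addrA subrK subrr.
pose J := [set x | B x /\ (h + z) * x = 0].
have hJ : closed_ideal B J.
  split.
  - by move=> x [].
  - split; first by split; [exact: subalg0 | rewrite mulr0].
    + move=> x y [Bx x0] [By y0]; split; first exact: subalgD.
      by rewrite mulrDr x0 y0 addr0.
    + move=> k x [Bx x0]; split; first exact: subalgZ.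
      by rewrite -scalerAr x0 scaler0.
  - move=> a x Ba [Bx x0]; split; first exact: subalgM.
    by rewrite mulrA hzC // -mulrA x0 mulr0.
  - move=> a x Ba [Bx x0]; split; first exact: subalgM.
    by rewrite mulrA x0 mul0r.
  - move=> u x uJ ux; split.
      by have cl := Defs.subalg_closed hB; apply: (cl u) ux => k; case: (uJ k).
    apply: (@eq0_small _ _ _ (cnorm (h + z))) => e e0.
    have [N /(_ N (leqnn _)) HN] := (cvg0P _ _).1 ux e e0.
    have -> : (h + z) * x = (h + z) * (x - u N) by rewrite mulrBr (uJ N).2 subr0.
    apply: le_trans (cnormM _ _) _; rewrite cnorm_distC.
    by apply: ler_wpM2l; [exact: cnorm_ge0 | exact: ltW].
have [J0|JB] := sB J hJ.
  left; suff -> : z = h by [].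
  by have : J (h - z) by []; rewrite J0 => /subr0_eq ->.
right; suff -> : - z = h by [].
have [_] : J 1 by rewrite JB; exact: subalg1.
by rewrite mulr1 => /eqP; rewrite addrC addr_eq0 => /eqP ->; rewrite opprK.
Qed.

(** A Dedekind cut: every real t satisfies z >= t or z <= t, and since positivity is a closed
    condition, z equals the supremum of the t below it. *)
Lemma simple_sa_center B z : cstar_subalg B -> simple_alg B ->
  rel_commutant B B z -> star z = z -> exists r : R, z = r%:C%C *: 1.
Proof.
(* The cut could be unbounded only in the zero algebra, where z is a scalar anyway; excluding
   scalars first covers this case. *)
move=> hB sB Zz sz; have [//|noZ] := pselect (exists r : R, z = r%:C%C *: 1).
have hZ : cstar_subalg (rel_commutant B B).
  by apply: cstar_subalg_commutant => // c; apply: subalg_star.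
have sgn t : cpos (z - t%:C%C *: 1) \/ cpos (t%:C%C *: 1 - z).
  rewrite -(opprB z); apply: (simple_central_sign hB sB).
    by apply: subalgB => //; apply: subalgZ => //; exact: subalg1.
  by rewrite starB star_real star1 sz.
pose X := [set t | cpos (z - t%:C%C *: 1)].
have X0 : X (- cnorm z).
  apply: (@cposP _ _ _ (cnorm z)); first by rewrite starB star_real star1 sz.
  by rewrite rmorphN scaleNr opprK opprD addrCA subrr addr0 cnormN.
have Xub : ubound X (cnorm z).
  move=> t Xt; rewrite leNgt; apply/negP => zt; apply: noZ; exists t.
  apply/eqP; rewrite -subr_eq0; apply/eqP; apply: cpos_antisym => //.
  rewrite opprB; apply: (@cposP _ _ _ t); first by rewrite starB star_real star1 sz.
  by rewrite subKr ltW.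
have hs : has_sup X by split; [exists (- cnorm z) | exists (cnorm z)].
pose s := sup X; exists s; apply/eqP; rewrite -subr_eq0; apply/eqP.
have dist t x : cnorm (x - s%:C%C *: 1 - (x - t%:C%C *: 1)) <= `|t - s|.
  rewrite opprB addrC addrA subrK -scalerBl -rmorphB cnormZr.
  by rewrite ler_piMr // cnorm1_le1.
apply: cpos_antisym; apply: cpos_closed => e e0.
  have [t Xt st] := sup_adherent e0 hs; exists (z - t%:C%C *: 1) => //.
  apply: le_trans (dist _ _) _; have : t <= s by apply: ub_le_sup => //; case: hs.
  by move=> ts; rewrite ler0_norm ?subr_le0 // opprB lerBlDr -lerBlDl ltW.
exists (- (z - (s + e)%:C%C *: 1)).
  have [Xt|] := sgn (s + e); last by rewrite opprB.
  have : s + e <= s by apply: ub_le_sup => //; case: hs.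
  by rewrite gerDl leNgt e0.
rewrite -opprD cnormN; apply: le_trans (dist _ _) _.
by rewrite addrAC subrr add0r ger0_norm // ltW.
Qed.

Lemma cartesian_decomp x : exists u v, [/\ x = u + 'i%C *: v, star u = u, star v = v &
  u = 2^-1%:C%C *: (x + star x) /\ v = (- 'i%C * 2^-1%:C%C) *: (x - star x)].
Proof.
exists (2^-1%:C%C *: (x + star x)), ((- 'i%C * 2^-1%:C%C) *: (x - star x)); split=> //.
- rewrite scalerA mulrA mulrN -expr2 sqr_i opprK mul1r -scalerDr.
  by rewrite addrACA subrr addr0 scale_half2.
- by rewrite star_real starD starK addrC.
- rewrite starZ starB starK -opprB scalerN -scaleNr; congr (_ *: _).
  by apply/eqP; rewrite eq_complex /=; apply/andP; split; apply/eqP; lra.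
Qed.

End SimpleCenter.

(** * Conditional expectations *)

Ltac mem := intros; repeat (first [ by [] | apply: subalgD | apply: subalgB | apply: subalgN
  | apply: subalgZ | apply: subalgM | apply: Defs.subalg_star | apply: subalg1 ]).

Section CondExp.
Context {R : realType} {M : cstarType R}.
Implicit Types (x y z a b c d h p : M) (r t : R).
Variables (A B : set M) (E : M -> M).
Hypotheses (hA : cstar_subalg A) (hB : cstar_subalg B) (hBA : B `<=` A).
Hypothesis hE : cond_exp A B E.

Lemma ce0 : E 0 = 0.
Proof. by rewrite -(scale0r (0 : M)) (ceZ hE) ?scale0r //; apply: subalg0. Qed.

Lemma ceN x : A x -> E (- x) = - E x.
Proof. by move=> Ax; rewrite -scaleN1r (ceZ hE) // scaleN1r. Qed.

Lemma ceB x y : A x -> A y -> E (x - y) = E x - E y.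
Proof. by move=> Ax Ay; rewrite (ceD hE) ?ceN //; mem. Qed.

Lemma ce_sum (I : eqType) (s : seq I) (F : I -> M) : (forall i, i \in s -> A (F i)) ->
  E (\sum_(i <- s) F i) = \sum_(i <- s) E (F i).
Proof.
elim: s => [|i s IH] HF; first by rewrite !big_nil ce0.
rewrite !big_cons (ceD hE) ?IH //.
- by move=> j js; apply: HF; rewrite in_cons js orbT.
- by apply: HF; rewrite mem_head.
- by apply: subalg_sum => // j js; apply: HF; rewrite in_cons js orbT.
Qed.

Lemma ceMl b x : B b -> A x -> E (b * x) = b * E x.
Proof.
move=> Bb Ax; have := ce_bimod hE Bb Ax (subalg1 hB).
by rewrite !mulr1.
Qed.

Lemma ceMr x b : A x -> B b -> E (x * b) = E x * b.
Proof.
move=> Ax Bb; have := ce_bimod hE (subalg1 hB) Ax Bb.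
by rewrite !mul1r.
Qed.

(** Compatibility with the adjoint is not among the axioms of [cond_exp]; it follows from positivity
    through the polarisation 4u = (u + 1)^2 - (u - 1)^2. *)
Lemma ce_sa u : A u -> star u = u -> star (E u) = E u.
Proof.
move=> Au su; have A1 := subalg1 hA.
have sq x : A x -> star x = x -> star (E (x * x)) = E (x * x).
  by move=> Ax sx; have := ce_pos hE Ax; rewrite sx => /cpos_star.
have -> : u = 2^-1%:C%C *: (2^-1%:C%C *: ((u + 1) * (u + 1) - (u - 1) * (u - 1))).
  have -> : (u + 1) * (u + 1) - (u - 1) * (u - 1) = (u + u) + (u + u).
    have -> : (u + 1) * (u + 1) = u * u + (u + u) + 1.
      by rewrite mulrDl mulrDr mulr1 mul1r !addrA.
    have -> : (u - 1) * (u - 1) = u * u - (u + u) + 1.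
      by rewrite mulrBl mulrBr mulr1 mul1r opprB opprD !addrA addrAC.
    by rewrite opprD addrACA subrr addr0 opprB addrC addrA subrK.
  by rewrite !scale_half2.
rewrite !(ceZ hE) ?ceB; try by mem.
rewrite !star_real starB !sq //; try by mem.
  by rewrite starB star1 su.
by rewrite starD star1 su.
Qed.

Lemma ce_star x : A x -> E (star x) = star (E x).
Proof.
move=> Ax; have [u [v [xE su sv [uE vE]]]] := cartesian_decomp x.
have Au : A u by rewrite uE; mem.
have Av : A v by rewrite vE; mem.
rewrite xE star_cartesian // ceB ?(ceD hE) ?(ceZ hE); try by mem.
by rewrite star_cartesian ?ce_sa.
Qed.

Lemma ce_cpos a : A a -> cpos a -> cpos (E a).
Proof.
move=> Aa /(cpos_sqrt hA Aa)[h [Ah sh _ ->]].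
by rewrite -{1}sh; apply: ce_pos hE _ Ah.
Qed.

(** Dividing by |t| and letting t tend to both infinities gives p >= 0 and -p >= 0, since the
    positive cone is closed. *)
Lemma cpos_line p c : (forall t, cpos (t%:C%C *: p + c)) -> p = 0.
Proof.
have main q : (forall t, 0 < t -> cpos (t%:C%C *: q + c)) -> cpos q.
  move=> H; apply: cpos_closed => e e0.
  have c0 := cnorm_ge0 c; pose t := cnorm c / e + 1.
  have t0 : 0 < t by rewrite ltr_wpDl // divr_ge0 // ltW.
  exists (t^-1%:C%C *: (t%:C%C *: q + c)).
    by apply: cposZ; [rewrite invr_ge0 ltW | apply: H].
  rewrite scalerDr scalerA -rmorphM mulVf ?gt_eqF // scale1r opprD addrA subrr sub0r.
  rewrite cnormN cnormZr ger0_norm ?invr_ge0 ?(ltW t0) // ler_pdivrMl //.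
  by rewrite mulrDl mul1r mulfVK ?gt_eqF // lerDl ltW.
move=> H; apply: cpos_antisym; apply: main => t _ //.
by rewrite scalerN -scaleNr -rmorphN; apply: H.
Qed.

(** When E (star y * y) = 0, the positive element E |t y + z|^2 is affine in t, so its slope, the
    real part of E (star z * y), vanishes. Replacing z by i z disposes of the imaginary part. *)
Lemma ce_cauchy_schwarz y z : A y -> A z -> E (star y * y) = 0 -> E (star z * y) = 0.
Proof.
move=> Ay Az y0.
have real z' : A z' -> E (star z' * y) + star (E (star z' * y)) = 0.
  move=> Az'; rewrite -ce_star ?starM ?starK; last by mem.
  apply: (@cpos_line _ (E (star z' * z'))) => t.
  have : cpos (E (star (t%:C%C *: y + z') * (t%:C%C *: y + z'))).
    by apply: ce_pos hE _ _; mem.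
  rewrite starD star_real mulrDl !mulrDr -!scalerAl -!scalerAr.
  rewrite !(ceD hE) ?(ceZ hE); try by mem.
  by rewrite y0 !scaler0 add0r addrA -scalerDr [E (star y * z') + _]addrC.
have := real z Az; have := real ('i%C *: z) ltac:(by mem).
rewrite starZ -scalerAl (ceZ hE) ?starZ; last by mem.
rewrite conjCK; set q := E _.
have -> : ('i%C : R[i])^* = - 'i%C by simpc.
rewrite scaleNr addrC => /subr0_eq iq.
have -> : star q = q.
  by have := congr1 ( *:%R (- 'i%C)) iq; rewrite !scalerA mulNr -expr2 sqr_i opprK !scale1r.
move=> /(congr1 (fun x => 2^-1%:C%C *: x)).
by rewrite scale_half2 scaler0.
Qed.

Section QuasiBasis.
Variable s : seq M.
Hypothesis hs : quasi_basis A E s.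

Lemma qb_nondegenerate x : A x -> (forall z, A z -> E (z * x) = 0) -> x = 0.
Proof.
move=> Ax H; rewrite (qb_left hs Ax) big1_seq // => l /andP[_ ls].
by rewrite H ?mulr0 //; apply: subalg_star => //; apply: qb_in hs _ ls.
Qed.

Lemma ce_faithful y : A y -> E (star y * y) = 0 -> y = 0.
Proof.
move=> Ay y0; apply: qb_nondegenerate => // z Az.
by rewrite -(starK z); apply: ce_cauchy_schwarz => //; mem.
Qed.

(** In subfactor language, the left and right partial traces on B' in A agree up to the factor
    [k]. *)
Definition spherical (k : R[i]) : Prop := forall x, rel_commutant B A x ->
  E x = k *: \sum_(l <- s) l * x * star l.

(* theta is the modular automorphism of E on the relative commutant; the
   spherical condition forces theta^2 = 1, and theta is positive for the inner
   product E (x^* y), so theta = 1. *)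
Lemma spherical_tracial k : spherical k ->
  forall x y, rel_commutant B A x -> A y -> E (x * y) = E (y * x).
Proof.
move=> sph; pose N := rel_commutant B A.
have hN : cstar_subalg N.
  by apply: cstar_subalg_commutant => // c; apply: subalg_star.
have NA x : N x -> A x by case.
have sA l : l \in s -> A l by apply: qb_in hs _.
have sAs l : l \in s -> A (star l) by move=> /sA; apply: subalg_star.
have EA x : A x -> A (E x) by move=> Ax; apply: hBA; apply: ce_in hE _ Ax.
pose theta x := \sum_(l <- s) l * E (x * star l).
have thA x : A x -> A (theta x).
  move=> Ax; apply: subalg_sum => // l ls; have := sA l ls; have := sAs l ls.
  by move=> ? ?; apply: subalgM => //; apply: EA; mem.
have thE x y : N x -> A y -> E (y * theta x) = E (x * y).
  move=> Nx Ay; have Ax := NA _ Nx; rewrite mulr_sumr ce_sum; last first.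
    move=> l ls; have Al := sA l ls; have Als := sAs l ls.
    by mem; apply: EA; mem.
  rewrite [in RHS](qb_right hs Ay) mulr_sumr ce_sum; last first.
    move=> l ls; have Al := sA l ls; have Als := sAs l ls.
    by mem; apply: EA; mem.
  apply: eq_big_seq => l ls; have Al := sA l ls; have Als := sAs l ls.
  have Byl : B (E (y * l)) by apply: ce_in hE _ _; mem.
  rewrite mulrA ceMr; [|by mem|by apply: ce_in hE _ _; mem].
  by rewrite mulrA (Nx.2 _ Byl) -mulrA (ceMl Byl) //; mem.
have thN x : N x -> N (theta x).
  move=> Nx; split; first by apply: thA; apply: NA.
  move=> b Bb; have Ab := hBA Bb; have Ax := NA _ Nx; have At := thA _ Ax.
  apply/eqP; rewrite -subr_eq0; apply/eqP; apply: qb_nondegenerate; first by mem.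
  move=> z Az; rewrite mulrBr ceB; try by mem.
  rewrite !mulrA ceMr ?thE //; try by mem.
  by rewrite mulrA [E (_ * b)](ceMr _ Bb) ?subrr //; mem.
(* The only use of sphericality. By [thE], E (z * theta u) = E (u * z); the average yields the
   opposite relation E (theta u * z) = E (z * u). Combined, E (z * theta (theta u)) = E (z * u), so
   theta^2 = 1 by faithfulness. *)
have PsiE u z : N u -> N z -> E (theta u * z) = E (z * u).
  move=> Nu Nz; have Nt := thN _ Nu; have [[Au Az] At] := (NA _ Nu, NA _ Nz, NA _ Nt).
  rewrite !sph; try by mem.
  congr (_ *: _).
  transitivity (\sum_(l <- s) \sum_(m <- s) m * E (star m * (l * theta u)) * z * star l).
    apply: eq_big_seq => l ls; have Al := sA l ls.
    rewrite !mulrA {1}(qb_left hs (subalgM hA Al At)) !mulr_suml.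
    by apply: eq_bigr => m _; rewrite !mulrA.
  rewrite exchange_big /=; apply: eq_big_seq => m ms.
  have Am := sA m ms; have Ams := sAs m ms.
  rewrite [RHS](_ : _ = m * z * (u * star m)); last by rewrite !mulrA.
  rewrite {1}(qb_right hs (subalgM hA Au Ams)) mulr_sumr.
  apply: eq_big_seq => l ls; have Al := sA l ls.
  rewrite [star m * _]mulrA thE //; last by mem.
  have Bq : B (E (u * (star m * l))) by apply: ce_in hE _ _; mem.
  by rewrite -[m * _ * z]mulrA -(Nz.2 _ Bq) !mulrA.
have th2 u : N u -> theta (theta u) = u.
  move=> Nu; have Nt := thN _ Nu; have Ntt := thN _ Nt; have [Au At] := (NA _ Nu, NA _ Nt).
  have Att := NA _ Ntt.
  apply/eqP; rewrite -subr_eq0; apply/eqP; set y := _ - u.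
  have Ny : N y by apply: subalgB.
  apply: ce_faithful; first exact: NA.
  have Ay := NA _ Ny; have Nys : N (star y) by apply: subalg_star.
  have Ays := NA _ Nys.
  rewrite {2}/y mulrBr ceB; try by mem.
  by rewrite thE // PsiE // subrr.
have th1 u : N u -> theta u = u.
  move=> Nu; have Nt := thN _ Nu; have [Au At] := (NA _ Nu, NA _ Nt).
  apply/eqP; rewrite -subr_eq0; apply/eqP; set y := _ - u.
  have Ny : N y by apply: subalgB.
  have Ay := NA _ Ny.
  (* For y in the -1 eigenspace, [thE] reads E (y * star y) = - E (star y * y), which forces both
     positive elements to be 0. *)
  have thy : theta y = - y.
    have -> : theta y = theta (theta u) - theta u.
      rewrite /theta -sumrB; apply: eq_big_seq => l ls; have Als := sAs l ls.
      by rewrite /y mulrBl ceB ?mulrBr //; mem.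
    by rewrite th2 // opprB.
  apply: ce_faithful => //.
  apply: cpos_antisym; first exact: ce_pos hE _ _.
  have Ays : A (star y) by mem.
  have -> : - E (star y * y) = E (y * star y).
    by rewrite -(thE y) // thy mulrN ceN //; mem.
  by rewrite -{1}(starK y); apply: ce_pos hE _ _.
by move=> x y Nx Ay; rewrite -thE // th1.
Qed.

End QuasiBasis.
End CondExp.

(** * Minimality *)

Section Minimal.
Context {R : realType} {M : cstarType R}.
Implicit Types (x y z a b c d h p : M) (r t : R).

(** Neumann series for the inverse of 1 - c: the increments c^k are dominated by 2^(-k), whose
    partial sums are [r]. The form j = 1 + c j, substituted into itself, gives the second-order
    expansion j = 1 + c + c^2 j. *)
Lemma neumann_inverse S c : @cstar_subalg R M S -> S c -> cnorm c <= 2^-1 ->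
  exists j, [/\ S j, j = 1 + c * j, c * j = j * c & cnorm j <= 2].
Proof.
move=> hS Sc c2; have HE : (2^-1 : R) = 1 / 2 by rewrite mul1r.
pose u := fix u k : M := if k is i.+1 then 1 + c * u i else 0.
pose r := fun k => (2 - 2 * (2^-1) ^+ k : R).
have pw k : 0 <= ((2^-1) ^+ k : R) by rewrite exprn_ge0 // invr_ge0.
have incr k : cnorm (u k.+1 - u k) <= r k.+1 - r k.
  have -> : r k.+1 - r k = (2^-1) ^+ k.
    by rewrite /r exprS; field.
  elim: k => [|k IH].
    by rewrite /= mulr0 addr0 subr0 expr0 cnorm1_le1.
  rewrite exprS [u k.+2]/= {2}/u -/u opprD addrACA subrr add0r -mulrBr.
  apply: le_trans (cnormM _ _) _.
  by apply: ler_pM => //; exact: cnorm_ge0.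
have r2 k : r k <= 2 by rewrite /r gerBl mulr_ge0.
have [j uj] := dominated_increments_cvg incr r2.
have uc k : u k * c = c * u k.
  elim: k => [|k IH] /=; first by rewrite mul0r mulr0.
  by rewrite mulrDl mulrDr mul1r mulr1 -mulrA IH.
exists j; split.
- have cl := Defs.subalg_closed hS; apply: (cl u) uj; elim=> [|k IH] /=.
    exact: subalg0.
  by mem.
- apply/eqP; rewrite -subr_eq0; apply/eqP; apply: (@eq0_small _ _ _ 2) => e e0.
  have [N HN] := (cvg0P _ _).1 uj e e0.
  have := HN N (leqnn _); have := HN N.+1 (leqnSn _).
  have := cnormB_le j (u N.+1) (1 + c * j); rewrite [cnorm (j - u _)]cnorm_distC.
  rewrite (_ : u N.+1 - (1 + _) = c * (u N - j)); last first.
    by rewrite /= opprD addrACA subrr add0r -mulrBr.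
  have := cnormM c (u N - j); have := cnorm_ge0 (u N - j); have := cnorm_ge0 c.
  nra.
- by apply/esym; apply: comm_norm_closed uj.
- apply: cnorm_le_limit uj => k.
  have : cnorm (u k) <= r k - r 0%N.
    elim: k => [|k IH]; first by rewrite /= cnorm0 subrr.
    have := incr k; have := cnormB_le (u k.+1) (u k) 0; rewrite !subr0; lra.
  by have := r2 k; rewrite /r expr0; lra.
Qed.

Variables (A B : set M) (E : M -> M) (s : seq M).
Hypotheses (hA : cstar_subalg A) (hB : cstar_subalg B).
Hypotheses (hE : cond_exp A B E) (hs : quasi_basis A E s).

Local Notation Psi x := (\sum_(l <- s) l * x * star l).

Lemma psiD x y : Psi (x + y) = Psi x + Psi y.
Proof. by rewrite -big_split; apply: eq_bigr => l _; rewrite mulrDr mulrDl. Qed.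

Lemma psiZ (k : R[i]) x : Psi (k *: x) = k *: Psi x.
Proof. by rewrite scaler_sumr; apply: eq_bigr => l _; rewrite -scalerAr -scalerAl. Qed.

Lemma psi_bounded : exists2 K : R, 0 <= K & forall x, cnorm (Psi x) <= K * cnorm x.
Proof.
elim: s => [|l s' [K K0 IH]].
  by exists 0 => // x; rewrite big_nil cnorm0 mul0r.
exists (cnorm l * cnorm (star l) + K); first by rewrite addr_ge0 ?mulr_ge0 ?cnorm_ge0.
move=> x; rewrite big_cons; apply: le_trans (cnorm_triangle _ _) _.
rewrite mulrDl lerD //; apply: le_trans (cnormM _ _) _; rewrite mulrAC.
by apply: ler_wpM2r; [exact: cnorm_ge0 | exact: cnormM].
Qed.

Hypothesis hmin : forall E' w', cond_exp A B E' -> watatani_index A E' w' ->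
  cpos (w' - Psi 1).

(* The competitor is E' = E (g . g) with g^2 = 1 + t k; its index is
   Psi ((1 + t k)^-1) = Psi 1 - t Psi k + O(t^2). *)
Lemma minimal_derivative_neg k : rel_commutant B A k -> star k = k -> E k = 0 ->
  cpos (- Psi k).
Proof.
move=> Nk sk Ek0; pose N := rel_commutant B A.
have hN : cstar_subalg N.
  by apply: cstar_subalg_commutant => // c; apply: subalg_star.
have [K K0 PK] := psi_bounded.
apply: cpos_closed => e e0.
(* [t * Y <= 1] keeps the norm of t k below 1/2, as the Neumann series requires; [t * X <= e] makes
   the second-order remainder, of size 2 K t^2 (cnorm k)^2, at most t e. The added 1 keeps both
   constants positive. *)
pose X := 2 * K * cnorm k ^+ 2 + 1; pose Y := 2 * (cnorm k + 1).
have X1 : 1 <= X by rewrite lerDr !mulr_ge0 ?exprn_ge0 ?cnorm_ge0.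
have k0 := cnorm_ge0 k; have Y1 : 2 <= Y by rewrite /Y; lra.
have [X0 Y0] : 0 < X /\ 0 < Y by split; lra.
have [t [t0 tY tX]] : exists t, [/\ 0 < t, t * Y <= 1 & t * X <= e].
  exists (Num.min Y^-1 (e / X)); split.
  - by rewrite lt_min invr_gt0 Y0 divr_gt0.
  - by rewrite -ler_pdivlMr // mul1r ge_min lexx.
  - by rewrite -ler_pdivlMr // ge_min lexx orbT.
pose c := - (t%:C%C *: k).
have Nc : N c by apply: subalgN => //; apply: subalgZ.
have sc : star c = c by rewrite /c starN star_real sk.
have nc : cnorm c = t * cnorm k by rewrite cnormN cnormZr ger0_norm // ltW.
have c2 : cnorm c <= 2^-1 by rewrite nc; move: tY; rewrite /Y; lra.
have [g [Ng gg _ sg]] := sqrt_one_sub hN Nc ltac:(move: c2; lra).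
have {}sg := sg sc.
have [j [Nj jE jc j2]] := neumann_inverse hN Nc c2.
have Ng' := Ng; have Nj' := Nj; case: Ng' => Ag gB; case: Nj' => Aj jB.
have ggj : g * g * j = 1 by rewrite gg mulrBl mul1r {1}jE addrK.
have jgg : j * (g * g) = 1 by rewrite gg mulrBr mulr1 -jc {1}jE addrK.
have gj : g * j = j * g.
  by rewrite -[LHS]mul1r -jgg -!mulrA (mulrA g g j) ggj mulr1.
have gjg : g * j * g = 1 by rewrite -mulrA -gj mulrA ggj.
have sj : star j = j.
  have : star j * (g * g) = 1 by have := congr1 star ggj; rewrite !starM sg star1.
  by move=> /(congr1 ( *%R^~ j)); rewrite -mulrA ggj mulr1 mul1r.
have Ac : A c by case: Nc.
have Ak : A k by case: Nk.
have E1 : E 1 = 1 := ce_id hE (subalg1 hB).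
have Ec : E c = 0.
  by rewrite /c (ceN hE) ?(ceZ hE) ?Ek0 ?scaler0 ?oppr0 //; mem.
have Egg : E (g * g) = 1.
  by rewrite gg (ceB hA hE) ?E1 ?Ec ?subr0 //; exact: subalg1.
pose E' x := E (g * x * g).
have hE' : cond_exp A B E'.
  split.
  - by move=> x Ax; apply: ce_in hE _ _; mem.
  - by move=> x y Ax Ay; rewrite /E' mulrDr mulrDl (ceD hE) //; mem.
  - by move=> q x Ax; rewrite /E' -scalerAr -scalerAl (ceZ hE) //; mem.
  - move=> b Bb; rewrite /E' gB // -mulrA (ceMl hB hE) ?Egg ?mulr1 //.
    by mem.
  - move=> b x b' Bb Ax Bb'; rewrite /E' -(ce_bimod hE) //; last by mem.
    by congr (E _); rewrite !mulrA (gB _ Bb) -!mulrA (gB _ Bb').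
  - move=> x Ax; rewrite /E' -{1}sg !mulrA -starM -mulrA.
    by apply: ce_pos hE _ _; mem.
have Agj : A (g * j) by mem.
have hw' : watatani_index A E' (Psi j).
  (* [g * j] is the inverse of g. Since it commutes with B, right multiplication by it turns a
     quasi-basis of E into one of E (g . g). *)
  exists [seq l * (g * j) | l <- s].
    split.
    - by move=> _ /mapP[l ls ->]; apply: subalgM => //; apply: qb_in hs _ ls.
    - move=> x Ax; rewrite big_map; have Axg : A (x * g) by mem.
      transitivity (\sum_(l <- s) l * E (star l * (x * g)) * (g * j)).
        by rewrite -mulr_suml -(qb_left hs Axg) -mulrA (mulrA g g) ggj mulr1.
      apply: eq_big_seq => l ls; have Als := subalg_star hA (qb_in hs ls).
      rewrite -[RHS]mulrA -[l * _ * _]mulrA; congr (_ * _).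
      have Nq := (subalgM hN Ng Nj).2; rewrite -Nq; last by apply: ce_in hE _ _; mem.
      by rewrite /E' !starM sg sj !mulrA gjg mul1r.
    - move=> x Ax; rewrite big_map; have Agx : A (g * x) by mem.
      transitivity (\sum_(l <- s) j * g * (E (g * x * l) * star l)).
        by rewrite -mulr_sumr -(qb_right hs Agx) mulrA -(mulrA j) jgg mul1r.
      apply: eq_big_seq => l ls; have Al := qb_in hs ls.
      have Nq := (subalgM hN Nj Ng).2.
      rewrite !starM sg sj mulrA Nq; last by apply: ce_in hE _ _; mem.
      rewrite -[LHS]mulrA /E'; congr (E _ * _).
      by rewrite -!mulrA (mulrA g j g) gjg mulr1.
  rewrite big_map; apply: eq_bigr => l _; rewrite !starM sg sj -!mulrA.
  congr (_ * _); rewrite ![in RHS]mulrA; congr (_ * _).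
  by rewrite gj -!mulrA (mulrA g j g) gjg mulr1.
have := hmin hE' hw'.
have jE2 : j = 1 + c + c * c * j by rewrite {1}jE {1}jE mulrDr mulr1 !mulrA addrA.
rewrite jE2 !psiD -[X in X - _]addrA [X in X - _]addrC addrK => pos.
(* This is (Psi j - Psi 1) / t, the difference quotient of the index; it is positive by minimality
   and within e of - Psi k. *)
exists (t^-1%:C%C *: (Psi c + Psi (c * c * j))).
  by apply: cposZ; rewrite // invr_ge0 ltW.
have -> : Psi c = - (t%:C%C *: Psi k) by rewrite /c -scaleNr psiZ scaleNr.
rewrite scalerDr scalerN scalerA -rmorphM mulVf ?gt_eqF // scale1r.
rewrite opprD opprK addrA addNr add0r cnormN cnormZr ger0_norm ?invr_ge0 ?(ltW t0) //.
rewrite ler_pdivrMl //; apply: le_trans (PK _) _.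
have : cnorm (c * c * j) <= cnorm c * cnorm c * 2.
  apply: le_trans (cnormM _ _) _; apply: ler_pM => //; try exact: cnorm_ge0.
  exact: cnormM.
move=> /(ler_wpM2l K0) /le_trans; apply; rewrite nc.
have -> : K * (t * cnorm k * (t * cnorm k) * 2) = t * (t * (X - 1)).
  by rewrite /X; ring.
by apply: ler_wpM2l; [exact: ltW | lra].
Qed.

Lemma minimal_derivative k : rel_commutant B A k -> star k = k -> E k = 0 ->
  Psi k = 0.
Proof.
move=> Nk sk k0; apply: cpos_antisym; last exact: minimal_derivative_neg.
have hN : cstar_subalg (rel_commutant B A).
  by apply: cstar_subalg_commutant => // c; apply: subalg_star.
have -> : Psi k = - Psi (- k) by rewrite -(scaleN1r k) psiZ scaleN1r opprK.
apply: minimal_derivative_neg; first exact: subalgN.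
  by rewrite starN sk.
by rewrite (ceN hE) ?k0 ?oppr0 //; case: Nk.
Qed.

(** For self-adjoint u in B', E u is central in B, hence a scalar r. Then u - r is in the kernel of
    E, where the index is stationary, so Psi u = r Psi 1. Cartesian parts give the general case. *)
Lemma minimal_spherical (tau : R[i]) : simple_alg B -> tau *: Psi 1 = 1 ->
  spherical A B E s tau.
Proof.
move=> sB tau1; pose N := rel_commutant B A.
have hN : cstar_subalg N.
  by apply: cstar_subalg_commutant => // c; apply: subalg_star.
have N1 := subalg1 hN; have A1 := subalg1 hA.
have sa u : N u -> star u = u -> E u = tau *: Psi u.
  move=> Nu su; have [Au uB] := Nu.
  have Zu : rel_commutant B B (E u).
    split; first exact: ce_in hE _ Au.
    by move=> b Bb; rewrite -(ceMr hB hE) // uB // (ceMl hB hE).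
  have sEu := ce_sa hA hE Au su.
  have [r Er] := simple_sa_center hB sB Zu sEu.
  have E1 : E 1 = 1 by apply: ce_id hE _ (subalg1 hB).
  have := @minimal_derivative (u - r%:C%C *: 1).
  rewrite (ceB hA hE) ?(ceZ hE) ?E1 ?Er ?subrr //; last by mem.
  rewrite starB star_real su star1 => /(_ _ erefl erefl) H.
  have {H} : Psi (u - r%:C%C *: 1) = 0 by apply: H; mem.
  rewrite -scaleNr psiD psiZ scaleNr => /subr0_eq ->.
  by rewrite scalerA mulrC -scalerA tau1.
move=> x Nx; have [u [v [xE su sv [uE vE]]]] := cartesian_decomp x.
have Nu : N u by rewrite uE; mem.
have Nv : N v by rewrite vE; mem.
have [Au Av] : A u /\ A v by split; [case: Nu | case: Nv].
rewrite xE (ceD hE) ?(ceZ hE) ?sa //; last by mem.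
by rewrite psiD psiZ scalerDr !scalerA [_ * tau]mulrC.
Qed.

End Minimal.

(** * The basic construction *)

Section BasicConstruction.
Context {R : realType} {M : cstarType R}.
Implicit Types (x y z a b c d h p : M) (r t : R).
Variables (A B D : set M) (E E' : M -> M) (e : M) (s : seq M) (tau q : R).
Hypotheses (hA : cstar_subalg A) (hB : cstar_subalg B) (hBA : B `<=` A).
Hypotheses (hE : cond_exp A B E) (hs : quasi_basis A E s).
Hypothesis hD : basic_construction A D E e.
Hypothesis hE' : cond_exp D A E'.
Hypothesis hdual : forall x y, A x -> A y -> E' (x * e * y) = tau%:C%C *: (x * y).
Hypothesis qq : q * q * tau = 1.

Let hDs := bc_subalg hD.
Let hAD := bc_sub hD.
Let De := bc_jones hD.
Let EB x : A x -> B (E x) := @ce_in _ _ _ _ _ hE x.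
Let EA x : A x -> A (E x).
Proof. by move=> Ax; apply/hBA/EB. Qed.
Let sA l : l \in s -> A l := @qb_in _ _ _ _ _ hs l.
Let sAs l : l \in s -> A (star l).
Proof. by move=> /sA; apply: subalg_star. Qed.

Let qqZ x : q%:C%C *: (q%:C%C *: (tau%:C%C *: x)) = x.
Proof. by rewrite !scalerA -!rmorphM (_ : _ * _ = 1) ?rmorph1 ?scale1r // -qq; ring. Qed.
Let tqqZ x : tau%:C%C *: (q%:C%C *: (q%:C%C *: x)) = x.
Proof. by rewrite !scalerA -!rmorphM (_ : _ * _ = 1) ?rmorph1 ?scale1r // -qq; ring. Qed.

(** This and the next relations are checked in the faithful representation [pi] on A. Here e acts as
    E, which is self-adjoint for the inner product E (star x * y). *)
Lemma jones_selfadjoint : star e = e.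
Proof.
have [pi rp] := bc_rep hD.
have Des : D (star e) by apply: subalg_star.
apply/eqP; rewrite -subr_eq0; apply/eqP; apply: (rep_inj rp); first by mem.
move=> y Ay; rewrite -scaleN1r (repD rp) ?(repZ rp) ?(rep_jones rp) ?scaleN1r //; last by mem.
have Apy : A (pi (star e) y) by apply: (rep_in rp).
have AEy := EA Ay.
apply: (qb_nondegenerate hA hs); first by mem.
move=> z Az; have Azs : A (star z) by apply: subalg_star.
rewrite -(starK z) mulrBr (ceB hA hE) ?starK; try by mem.
rewrite -{1}(starK z) -(rep_adj rp) // (rep_jones rp) // (ce_star hA hE) // starK.
by rewrite (ceMl hB hE) ?(ceMr hB hE) ?subrr //; apply: EB.
Qed.

Lemma jones_sandwich x : A x -> e * x * e = E x * e.
Proof.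
move=> Ax; have [pi rp] := bc_rep hD.
have [Dx DEx] : D x /\ D (E x) by split; apply: hAD => //; apply: EA.
apply/eqP; rewrite -subr_eq0; apply/eqP; apply: (rep_inj rp); first by mem.
move=> y Ay; have AEy := EA Ay; have AEx := EA Ax.
rewrite -scaleN1r (repD rp) ?(repZ rp) ?scaleN1r //; try by mem.
rewrite !(repM rp) ?(rep_jones rp) ?(rep_mul rp) ?(rep_jones rp) //; try by mem.
by rewrite (ceMr hB hE) ?subrr //; apply: EB.
Qed.

Lemma jones_comm b : B b -> e * b = b * e.
Proof.
move=> Bb; have [pi rp] := bc_rep hD; have Ab := hBA Bb; have Db := hAD Ab.
apply/eqP; rewrite -subr_eq0; apply/eqP; apply: (rep_inj rp); first by mem.
move=> y Ay; have AEy := EA Ay.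
rewrite -scaleN1r (repD rp) ?(repZ rp) ?scaleN1r //; try by mem.
rewrite !(repM rp) ?(rep_jones rp) ?(rep_mul rp) ?(rep_jones rp) //; try by mem.
by rewrite (ceMl hB hE) ?subrr.
Qed.

(** Under [pi] this is the quasi-basis expansion of y as the sum of l E (star l * y). *)
Lemma jones_resolution : \sum_(l <- s) l * e * star l = 1.
Proof.
have [pi rp] := bc_rep hD.
have rep0 y : A y -> pi 0 y = 0.
  by move=> Ay; rewrite -(scale0r (0 : M)) (repZ rp) ?scale0r //; apply: subalg0.
have rep_sum (s' : seq M) y : (forall l, l \in s' -> A l) -> A y ->
    pi (\sum_(l <- s') l * e * star l) y = \sum_(l <- s') l * E (star l * y).
  move=> s'A Ay; elim: s' s'A => [|l s' IH] s'A; first by rewrite !big_nil rep0.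
  have Al := s'A l (mem_head _ _); have Als := subalg_star hA Al.
  have Dl := hAD Al; have Dls := hAD Als.
  have s'A' m : m \in s' -> A m by move=> ms; apply: s'A; rewrite in_cons ms orbT.
  rewrite !big_cons (repD rp) ?IH //; [|by mem|]; last first.
    apply: subalg_sum => // m ms; have Dm := hAD (s'A' _ ms).
    by have Dms := subalg_star hDs Dm; mem.
  have Aly : A (star l * y) by mem.
  rewrite !(repM rp) ?(rep_mul rp Als Ay) ?(rep_jones rp Aly) //; try by mem.
  by rewrite (rep_mul rp) //; apply: EA.
have Dsum : D (\sum_(l <- s) l * e * star l).
  apply: subalg_sum => // l ls; have Dl := hAD (sA ls); have Dls := hAD (sAs ls).
  by mem.
have D1 : D 1 by apply: subalg1.
apply/eqP; rewrite -subr_eq0; apply/eqP; apply: (rep_inj rp); first by mem.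
move=> y Ay; rewrite -scaleN1r (repD rp) ?(repZ rp) ?scaleN1r //; try by mem.
rewrite rep_sum // (rep_mul rp) ?mul1r -?(qb_left hs Ay) ?subrr //.
exact: subalg1.
Qed.

Lemma basic_linear_eq (f g : M -> M) :
  (forall x y, D x -> D y -> f (x + y) = f x + f y) -> f 0 = 0 ->
  (forall x y, D x -> D y -> g (x + y) = g x + g y) -> g 0 = 0 ->
  (forall a b, A a -> A b -> f (a * e * b) = g (a * e * b)) ->
  forall d, D d -> f d = g d.
Proof.
move=> fD f0 gD g0 fg d /(bc_span hD)[t tA ->].
elim: t tA => [|[a b] t IH] tA; first by rewrite big_nil f0.
have [/= Aa Ab] := tA _ (mem_head _ _).
have tA' u : u \in t -> A u.1 /\ A u.2.
  by move=> ut; apply: tA; rewrite in_cons ut orbT.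
have [Da Db] : D a /\ D b by split; apply: hAD.
have Dt : D (\sum_(p <- t) p.1 * e * p.2) by apply/(bc_span hD); exists t.
by rewrite big_cons fD ?gD ?fg ?IH //; mem.
Qed.

Let D0 : E' 0 = 0 := ce0 hDs hE'.

(** Here q = tau^(-1/2). On a generator a e b, the identity e (star l * a) e = E (star l * a) e
    leaves one projection, and E' replaces it by tau, which q^2 cancels; what remains is the
    expansion of a or b over [s]. *)
Lemma dual_quasi_basis : quasi_basis D E' [seq q%:C%C *: (l * e) | l <- s].
Proof.
split.
- by move=> _ /mapP[l ls ->]; have Dl := hAD (sA ls); mem.
- move=> d Dd; rewrite big_map.
  apply: (@basic_linear_eq id (fun x => \sum_(l <- s) _)) Dd => //.
  + move=> x y Dx Dy; rewrite -big_split; apply: eq_big_seq => l ls /=.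
    have Dl := hAD (sA ls); have Dls := hAD (sAs ls).
    by rewrite mulrDr (ceD hE') ?mulrDr //; mem.
  + by rewrite big1 // => l _; rewrite mulr0 D0 mulr0.
  + move=> a b Aa Ab; rewrite {1}(qb_left hs Aa) !mulr_suml.
    apply: eq_big_seq => l ls; have [Al Als] := (sA ls, sAs ls).
    have [Dl Dls] := (hAD Al, hAD Als); have [Da Db] := (hAD Aa, hAD Ab).
    rewrite star_real starM jones_selfadjoint -!scalerAl (ceZ hE'); last by mem.
    have -> : e * star l * (a * e * b) = E (star l * a) * e * b.
      by rewrite -jones_sandwich; [rewrite !mulrA | mem].
    have Bla : B (E (star l * a)) by apply: EB; mem.
    rewrite hdual //; last by apply: hBA.
    rewrite -!scalerAr qqZ.
    by rewrite mulrA -[l * e * _]mulrA jones_comm // !mulrA.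
- move=> d Dd; rewrite big_map.
  apply: (@basic_linear_eq id (fun x => \sum_(l <- s) _)) Dd => //.
  + move=> x y Dx Dy; rewrite -big_split; apply: eq_big_seq => l ls /=.
    have Dl := hAD (sA ls); have Dls := hAD (sAs ls).
    by rewrite mulrDl (ceD hE') ?mulrDl //; mem.
  + by rewrite big1 // => l _; rewrite mul0r D0 mul0r.
  + move=> a b Aa Ab; rewrite {1}(qb_right hs Ab) !mulr_sumr.
    apply: eq_big_seq => l ls; have [Al Als] := (sA ls, sAs ls).
    have [Dl Dls] := (hAD Al, hAD Als); have [Da Db] := (hAD Aa, hAD Ab).
    rewrite star_real starM jones_selfadjoint -!scalerAr (ceZ hE'); last by mem.
    have Bbl : B (E (b * l)) by apply: EB; mem.
    have -> : a * e * b * (l * e) = a * E (b * l) * e * 1.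
      by rewrite mulr1 -[RHS]mulrA -jones_sandwich; [rewrite !mulrA | mem].
    rewrite hdual ?mulr1; [|by have := hBA Bbl; mem|exact: subalg1].
    rewrite -!scalerAl qqZ.
    by rewrite !mulrA -[a * e * _]mulrA jones_comm // !mulrA.
Qed.

(** The push-down lemma: D e = A e, and the element of A is recovered through E'. *)
Lemma jones_pushdown d : D d -> d * e = q%:C%C *: (q%:C%C *: (E' (d * e) * e)).
Proof.
move: d; apply: basic_linear_eq.
- by move=> x y _ _; rewrite mulrDl.
- by rewrite mul0r.
- by move=> x y Dx Dy; rewrite mulrDl (ceD hE') ?mulrDl ?scalerDr //; mem.
- by rewrite mul0r D0 mul0r !scaler0.
- move=> a b Aa Ab; have Bb := EB Ab; have Ab' := hBA Bb.
  have -> : a * e * b * e = a * E b * e by rewrite -mulrA -mulrA (mulrA e) jones_sandwich ?mulrA.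
  rewrite -{2}(mulr1 (a * E b * e)) hdual ?mulr1; [|by mem|exact: subalg1].
  by rewrite -scalerAl qqZ.
Qed.

(** Push x e down to z e with z in B' in A. Inserting the resolution of 1 gives E' x as the sum of l
    E' (x e) (star l), which is tau times the average of z, hence E z. On the other side e x e = e z
    e = E (z) e, so the average over the new quasi-basis collapses to E z as well. *)
Lemma dual_spherical : spherical A B E s tau%:C%C ->
  spherical D A E' [seq q%:C%C *: (l * e) | l <- s] tau%:C%C.
Proof.
move=> sph x [Dx xA]; rewrite big_map.
have Dxe : D (x * e) by mem.
pose z := q%:C%C *: (q%:C%C *: E' (x * e)).
have xe : x * e = z * e by rewrite /z -!scalerAl -jones_pushdown.
have Axe : A (E' (x * e)) by apply: ce_in hE' _ _.
have Az : A z by rewrite /z; mem.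
have Nz : rel_commutant B A z.
  split=> // b Bb; have Ab := hBA Bb; have Db := hAD Ab.
  rewrite /z -!scalerAl -!scalerAr; congr (_ *: (_ *: _)).
  rewrite -(ceMr hA hE') // -(ceMl hA hE') //.
  by rewrite -mulrA jones_comm // !mulrA xA.
have tz : tau%:C%C *: z = E' (x * e).
  by rewrite /z tqqZ.
have Ex : E' x = E z.
  rewrite (sph _ Nz) -{1}(mulr1 x) -jones_resolution mulr_sumr (ce_sum hDs hE'); last first.
    by move=> l ls; have Dl := hAD (sA ls); have Dls := hAD (sAs ls); mem.
  rewrite scaler_sumr; apply: eq_big_seq => l ls.
  have [Al Als] := (sA ls, sAs ls); have [Dl Dls] := (hAD Al, hAD Als).
  rewrite scalerAl scalerAr tz -(ce_bimod hE') //.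
  by rewrite !mulrA xA.
have Bz : B (E z) by apply: EB.
(* E z equals E' x, which commutes with A because x does; hence it can be pulled out of the sum past
   the letters l. *)
have zA a : A a -> a * E z = E z * a.
  by move=> Aa; have Da := hAD Aa; rewrite -Ex -(ceMr hA hE') // -(ceMl hA hE') // xA.
rewrite Ex; transitivity (tau%:C%C *: \sum_(l <- s) q%:C%C *: (q%:C%C *: (E z * (l * e * star l)))).
  by rewrite -!scaler_sumr -mulr_sumr jones_resolution mulr1 tqqZ.
congr (_ *: _); apply: eq_big_seq => l ls; have Al := sA ls.
rewrite star_real starM jones_selfadjoint -!scalerAl -scalerAr; congr (_ *: (_ *: _)).
rewrite !mulrA -zA // -[l * e * x * e]mulrA xe -!mulrA; congr (_ * _).
by rewrite !mulrA jones_sandwich // -mulrA.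
Qed.

End BasicConstruction.

(** * Composition of expectations *)

Section Composition.
Context {R : realType} {M : cstarType R}.
Implicit Types (x y z a b c d h p : M) (r t : R).

(** Both sides equal the double sum of n x G (star n * c * m) (star m): the coefficient lies in B
    and passes through x. *)
Lemma qb_average_comm C B (G : M -> M) (t : seq M) x : cstar_subalg C ->
  cond_exp C B G -> quasi_basis C G t -> (forall b, B b -> x * b = b * x) ->
  forall c, C c -> (\sum_(m <- t) m * x * star m) * c = c * \sum_(m <- t) m * x * star m.
Proof.
move=> hC hG ht xB c Cc; rewrite mulr_suml mulr_sumr.
have tC m : m \in t -> C m by apply: qb_in ht _.
have tCs m : m \in t -> C (star m) by move=> /tC; apply: subalg_star.
transitivity (\sum_(n <- t) \sum_(m <- t) n * x * (G (star n * c * m) * star m)).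
  apply: eq_big_seq => n nt; have Cnc : C (star n * c) by have := tCs _ nt; mem.
  by rewrite -mulr_sumr -(qb_right ht Cnc) !mulrA.
rewrite exchange_big; apply: eq_big_seq => m mt /=.
have Ccm : C (c * m) by have := tC _ mt; mem.
rewrite !mulrA {1}(qb_left ht Ccm) !mulr_suml; apply: eq_big_seq => n nt.
have Bq : B (G (star n * c * m)) by apply: ce_in hG _ _; have := tC _ mt; have := tCs _ nt; mem.
by rewrite !mulrA -[n * x * _]mulrA xB // !mulrA.
Qed.

Variables (A C B : set M) (F G : M -> M) (s t : seq M).
Hypotheses (hA : cstar_subalg A) (hC : cstar_subalg C).
Hypotheses (hCA : C `<=` A) (hBC : B `<=` C).
Hypotheses (hF : cond_exp A C F) (hG : cond_exp C B G).
Hypotheses (hs : quasi_basis A F s) (ht : quasi_basis C G t).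

Lemma comp_cond_exp : cond_exp A B (G \o F).
Proof.
split=> /=.
- by move=> x Ax; apply: ce_in hG _ _; apply: ce_in hF _ _.
- by move=> x y Ax Ay; rewrite (ceD hF) // (ceD hG) //; apply: ce_in hF _ _.
- by move=> k x Ax; rewrite (ceZ hF) // (ceZ hG) //; apply: ce_in hF _ _.
- by move=> b Bb; rewrite (ce_id hF) ?(ce_id hG) //; apply: hBC.
- move=> b x b' Bb Ax Bb'; rewrite (ce_bimod hF) ?(ce_bimod hG) //; try exact: hBC.
  by apply: ce_in hF _ _.
- move=> x Ax; apply: (ce_cpos hC hG); last exact: ce_pos hF _ _.
  by apply: ce_in hF _ _; mem.
Qed.

Lemma comp_quasi_basis : quasi_basis A (G \o F) [seq l * m | l <- s, m <- t].
Proof.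
have sA l : l \in s -> A l by apply: qb_in hs _.
have sAs l : l \in s -> A (star l) by move=> /sA; apply: subalg_star.
have tC m : m \in t -> C m by apply: qb_in ht _.
have tCs m : m \in t -> C (star m) by move=> /tC; apply: subalg_star.
split=> /=.
- by move=> _ /allpairsP[[l m] /= [ls mt ->]]; have := sA _ ls; have := hCA (tC _ mt); mem.
- move=> x Ax; rewrite big_allpairs_dep {1}(qb_left hs Ax); apply: eq_big_seq => l ls.
  have Alx : A (star l * x) by have := sAs _ ls; mem.
  rewrite {1}(qb_left ht (ce_in hF Alx)) mulr_sumr; apply: eq_big_seq => m mt.
  by rewrite starM -!mulrA (ceMl hC hF (tCs _ mt)).
- move=> x Ax; rewrite big_allpairs_dep {1}(qb_right hs Ax); apply: eq_big_seq => l ls.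
  have Axl : A (x * l) by have := sA _ ls; mem.
  rewrite {1}(qb_right ht (ce_in hF Axl)) mulr_suml; apply: eq_big_seq => m mt.
  by rewrite starM !mulrA (ceMr hC hF _ (tC _ mt)).
Qed.

(** Sphericality of G applies to F x, and by bimodularity the average over [t] slides inside F. The
    averaged element y commutes with C, so sphericality of F applies to it in turn. *)
Lemma comp_spherical k1 k2 : spherical A C F s k1 -> spherical C B G t k2 ->
  spherical A B (G \o F) [seq l * m | l <- s, m <- t] (k2 * k1).
Proof.
move=> sphF sphG x [Ax xB] /=.
have tC m : m \in t -> C m by apply: qb_in ht _.
have tCs m : m \in t -> C (star m) by move=> /tC; apply: subalg_star.
pose y := \sum_(m <- t) m * x * star m.
have Ny : rel_commutant C A y.
  split; last by move=> c Cc; exact: (qb_average_comm hC hG ht xB).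
  by apply: subalg_sum => // m mt; have := hCA (tC _ mt); have := hCA (tCs _ mt); mem.
have NF : rel_commutant B C (F x).
  split; first exact: ce_in hF _ _.
  move=> b Bb; have Cb := hBC Bb.
  by rewrite -(ceMr hC hF) // xB // (ceMl hC hF).
rewrite (sphG _ NF).
have -> : \sum_(m <- t) m * F x * star m = F y.
  rewrite (ce_sum hA hF); last first.
    by move=> m mt; have := hCA (tC _ mt); have := hCA (tCs _ mt); mem.
  by apply: eq_big_seq => m mt; rewrite (ce_bimod hF) //; [apply: tC | apply: tCs].
rewrite (sphF _ Ny) scalerA big_allpairs_dep; congr (_ *: _); apply: eq_bigr => l _.
rewrite /y mulr_sumr mulr_suml; apply: eq_bigr => m _.
by rewrite starM !mulrA.
Qed.

End Composition.

(** * The Jones tower *)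

Section Tower.
Context {R : realType} {M : cstarType R}.
Implicit Types (x y z a b c d h p : M) (r t : R).
Variables (A B : set M) (T : jones_tower B A).
Hypotheses (hA : cstar_subalg A) (hB : cstar_subalg B) (hBA : B `<=` A).
Hypothesis sB : simple_alg B.

Local Notation tau := (tw_tau T).
Local Notation E := (tw_exp T).
Local Notation e := (tw_jones T).
Local Notation v := (vprod T).
Local Notation tr := (tr T).

(* level n is A_(n-1), so that E n maps level n.+1 onto level n. *)
Definition level (n : nat) : set M := if n is m.+1 then tw_alg T m else B.

Lemma level_subalg n : cstar_subalg (level n).
Proof.
by case: n => [|[|n]] //=; [rewrite tw_alg0 | exact: bc_subalg (tw_basic T n)].
Qed.
Hint Resolve level_subalg : core.

Lemma level_sub n : level n `<=` level n.+1.
Proof.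
by case: n => [|n] /=; [rewrite tw_alg0 | exact: bc_sub (tw_basic T n)].
Qed.

Lemma level_mono m n : (m <= n)%N -> level m `<=` level n.
Proof.
move=> /subnKC <-; elim: (n - m)%N => [|k IH]; first by rewrite addn0.
by rewrite addnS => x /IH; apply: level_sub.
Qed.

Lemma level_exp n : cond_exp (level n.+1) (level n) (E n).
Proof.
case: n => [|n] /=; last exact: tw_cond_exp.
by rewrite tw_alg0; case: (tw_minimal T).
Qed.

Definition isqrt_tau : R := (Num.sqrt tau)^-1.

Lemma isqrt_tauP : isqrt_tau * isqrt_tau * tau = 1.
Proof.
have t0 := tw_tau_gt0 T; rewrite -invfM -expr2 sqr_sqrtr ?(ltW t0) //.
by rewrite mulVf ?gt_eqF.
Qed.

Variable s : seq M.
Hypothesis hs : quasi_basis A (E 0) s.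
Hypothesis hw : (tau^-1)%:C%C *: 1 = \sum_(l <- s) l * star l.

Fixpoint level_basis (n : nat) : seq M :=
  if n is m.+1 then [seq isqrt_tau%:C%C *: (l * e m.+1) | l <- level_basis m] else s.

Lemma level_basisP n : quasi_basis (level n.+1) (E n) (level_basis n) /\
  spherical (level n.+1) (level n) (E n) (level_basis n) tau%:C%C.
Proof.
elim: n => [|n [qb sph]] /=.
  rewrite tw_alg0; split=> //; have [hE _ hmin] := tw_minimal T.
  have P1 : \sum_(l <- s) l * 1 * star l = (tau^-1)%:C%C *: 1.
    by rewrite hw; apply: eq_bigr => l _; rewrite mulr1.
  have hmin' E' w' : cond_exp A B E' -> watatani_index A E' w' ->
      cpos (w' - \sum_(l <- s) l * 1 * star l).
    by rewrite P1; apply: hmin.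
  apply: (minimal_spherical hA hB hE hs hmin' sB).
  rewrite P1 scalerA -rmorphM divff ?rmorph1 ?scale1r //.
  by rewrite gt_eqF // tw_tau_gt0.
have hD : basic_construction (level n.+1) (level n.+2) (E n) (e n.+1) := tw_basic T n.
have dual := @tw_dual _ _ _ _ T n.
split.
  exact: (dual_quasi_basis (level_subalg _) (level_subalg _) (@level_sub n)
    (level_exp n) qb hD (level_exp n.+1) dual isqrt_tauP).
exact: (dual_spherical (level_subalg _) (level_subalg _) (@level_sub n)
  (level_exp n) qb hD (level_exp n.+1) dual isqrt_tauP sph).
Qed.

(** [spherical_tracial] accepts any constant, so the composite quasi-basis and its factor can stay
    existential. *)
Lemma tr_data n : exists (t : seq M) (k : R[i]), [/\ cond_exp (level n.+1) B (tr n),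
  quasi_basis (level n.+1) (tr n) t & spherical (level n.+1) B (tr n) t k].
Proof.
elim: n => [|n [t [k [hG ht sph]]]].
  by exists (level_basis 0), tau%:C%C; have [] := level_basisP 0; split=> //; exact: level_exp 0.
have [qb sphF] := level_basisP n.+1.
exists [seq l * m | l <- level_basis n.+1, m <- t], (k * tau%:C%C).
have BL : B `<=` level n.+1 by apply: (@level_mono 0).
have hL1 := level_subalg n.+1; have hL2 := level_subalg n.+2.
have sub := @level_sub n.+1; have hF := level_exp n.+1.
split.
- exact: (comp_cond_exp hL2 hL1 BL hF hG).
- exact: (comp_quasi_basis hL2 hL1 sub hF qb ht).
- exact: (comp_spherical hL2 hL1 sub BL hF hG ht sphF sph).
Qed.

Lemma tr_exp n : cond_exp (level n.+1) B (tr n).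
Proof. by have [t [k []]] := tr_data n. Qed.

Lemma tr_tracial n x y : rel_commutant B (level n.+1) x -> level n.+1 y ->
  tr n (x * y) = tr n (y * x).
Proof.
have [t [k [hG ht sph]]] := tr_data n.
by apply: (spherical_tracial _ _ _ hG ht sph) => //; apply: (@level_mono 0).
Qed.

Lemma tr_faithful n x : level n.+1 x -> tr n (star x * x) = 0 -> x = 0.
Proof. by have [t [k [hG ht _]]] := tr_data n; apply: (ce_faithful _ hG ht). Qed.

Lemma e_level n : level n.+2 (e n.+1).
Proof. exact: bc_jones (tw_basic T n). Qed.

Lemma e_star n : star (e n.+1) = e n.+1.
Proof.
have [qb _] := level_basisP n.
exact: (jones_selfadjoint (level_subalg _) (level_subalg _) (@level_sub n) (level_exp n) qb (tw_basic T n)).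
Qed.

Lemma e_sandwich n x : level n.+1 x -> e n.+1 * x * e n.+1 = E n x * e n.+1.
Proof.
exact: (jones_sandwich (level_subalg _) (level_subalg _) (@level_sub n) (level_exp n) (tw_basic T n)).
Qed.

Lemma e_comm n m x : (m <= n)%N -> level m x -> e n.+1 * x = x * e n.+1.
Proof.
move=> mn /(level_mono mn).
exact: (jones_comm (level_subalg _) (level_subalg _) (@level_sub n) (level_exp n) (tw_basic T n)).
Qed.

Lemma v_level n : level n.+1 (v n).
Proof.
elim: n => [|n IH] /=; first exact: (subalg1 (level_subalg 1)).
apply: (subalgM (level_subalg n.+2)); first exact: e_level.
exact: (@level_sub n.+1).
Qed.

Lemma v_commB n b : B b -> v n * b = b * v n.
Proof.
move=> Bb; elim: n => [|n IH] /=; first by rewrite mul1r mulr1.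
by rewrite -mulrA IH !mulrA (@e_comm n 0).
Qed.

Lemma level_basisE n : level_basis n = [seq (isqrt_tau ^+ n)%:C%C *: (l * star (v n)) | l <- s].
Proof.
elim: n => [|n IH] /=.
  by rewrite -[LHS]map_id; apply: eq_map => l; rewrite star1 mulr1 scale1r.
rewrite IH -map_comp; apply: eq_map => l /=.
by rewrite -scalerAl scalerA -rmorphM -exprS starM e_star mulrA.
Qed.

Lemma E_dual n x y : level n.+1 x -> level n.+1 y ->
  E n.+1 (x * e n.+1 * y) = tau%:C%C *: (x * y).
Proof. exact: tw_dual. Qed.

Lemma qb_v_right n x : level n.+1 x ->
  x = (isqrt_tau ^+ n * isqrt_tau ^+ n)%:C%C *: \sum_(l <- s) E n (x * l * star (v n)) * v n * star l.
Proof.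
move=> Lx; have [qb _] := level_basisP n.
rewrite {1}(qb_right qb Lx) level_basisE big_map scaler_sumr.
apply: eq_big_seq => l ls.
have Ll : level n.+1 l by apply: (@level_mono 1) => //=; rewrite tw_alg0; apply: qb_in hs _ ls.
have Lv := v_level n.
rewrite star_real starM starK -!scalerAr (ceZ (level_exp n)); last by mem.
by rewrite -scalerAl scalerA -rmorphM !mulrA.
Qed.


Lemma basis_level n l : l \in s -> level n.+1 l.
Proof. by move=> ls; apply: (@level_mono 1) => //=; rewrite tw_alg0; apply: qb_in hs _ ls. Qed.

Lemma basis_star_level n l : l \in s -> level n.+1 (star l).
Proof. by move=> /(basis_level n); apply: subalg_star. Qed.

Lemma B_level n b : B b -> level n b.
Proof. exact: (@level_mono 0). Qed.

Lemma A_level n a : A a -> level n.+1 a.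
Proof. by move=> Aa; apply: (@level_mono 1) => //=; rewrite tw_alg0. Qed.

Lemma commB_subalg n : cstar_subalg (rel_commutant B (level n)).
Proof. by apply: cstar_subalg_commutant => // c; apply: subalg_star. Qed.

Lemma commA_subalg n : cstar_subalg (rel_commutant A (level n)).
Proof. by apply: cstar_subalg_commutant => // c; apply: subalg_star. Qed.
Hint Resolve commB_subalg commA_subalg : core.

Lemma commA_commB n : rel_commutant A (level n) `<=` rel_commutant B (level n).
Proof. by move=> x [Lx xA]; split=> // b /hBA; apply: xA. Qed.

Lemma E_in n x : level n.+1 x -> level n (E n x).
Proof. exact: ce_in (level_exp n) x. Qed.

Lemma E_commB n x : rel_commutant B (level n.+1) x -> rel_commutant B (level n) (E n x).
Proof.
move=> [Lx xB]; split; first exact: E_in.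
move=> b Bb; have Lb := B_level n Bb; have hE := level_exp n.
by rewrite -(ceMr (level_subalg n) hE) // xB // (ceMl (level_subalg n) hE).
Qed.

Definition average x : M := tau%:C%C *: \sum_(l <- s) l * x * star l.

Lemma average_commA n x : rel_commutant B (level n.+1) x ->
  rel_commutant A (level n.+1) (average x).
Proof.
move=> [Lx xB]; have [hE _ _] := tw_minimal T; split.
  apply: subalgZ => //; apply: subalg_sum => // l ls.
  by have := basis_level n ls; have := basis_star_level n ls; mem.
by move=> a Aa; rewrite -scalerAl -scalerAr (qb_average_comm hA hE hs xB).
Qed.

(** The letters l lie in A, so every later expectation commutes with averaging; the claim descends
    to B' in A, where sphericality identifies [average x] with E_0 x. *)
Lemma tr_average n x : rel_commutant B (level n.+1) x -> tr n (average x) = tr n x.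
Proof.
elim: n x => [|n IH] x Nx /=.
  have [_ sph] := level_basisP 0; rewrite /average -(sph x Nx).
  by apply: ce_id (level_exp 0) _ _; apply: E_in; case: Nx.
have hE := level_exp n.+1; rewrite -[RHS]IH; last exact: E_commB.
have [Lx _] := Nx; congr (tr n _); rewrite /average.
have Ll l : l \in s -> level n.+2 (l * x * star l).
  by move=> ls; have := basis_level n.+1 ls; have := basis_star_level n.+1 ls; mem.
rewrite (ceZ hE) ?(ce_sum (level_subalg _) hE) //; last exact: subalg_sum.
congr (_ *: _); apply: eq_big_seq => l ls.
by rewrite (ce_bimod hE) //; [apply: basis_level | apply: basis_star_level].
Qed.

(** Orthogonal-projection argument: for y in A', both F and [average] are linear over star y and
    preserve tr, so F x and [average x] pair equally with y. Taking y to be their difference,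
    faithfulness of tr gives y = 0. *)
Lemma average_unique k (F : M -> M) : tr_preserving_cond_exp T k F ->
  forall x, rel_commutant B (level k.+1) x -> F x = average x.
Proof.
move=> [hF trF] x Nx.
have hE := tr_exp k; have NFx : rel_commutant A (level k.+1) (F x) by apply: ce_in hF _ _.
have Nav := average_commA Nx.
apply/eqP; rewrite -subr_eq0; apply/eqP; set y := _ - _.
have Ny : rel_commutant A (level k.+1) y by apply: subalgB.
have Nys : rel_commutant A (level k.+1) (star y) by apply: subalg_star.
have NBys := commA_commB Nys.
have [[Ly _] [Lys ysA]] := (Ny, Nys).
have [[LFx _] [Lav _] [Lx _]] := And3 NFx Nav Nx.
have Nyx : rel_commutant B (level k.+1) (star y * x) by apply: subalgM.
apply: (@tr_faithful k) => //.
rewrite {2}/y mulrBr (ceB (level_subalg _) hE) //; try by mem.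
rewrite -(ceMl (commA_subalg k.+1) hF) // trF // -[X in X - _](tr_average Nyx).
rewrite (_ : average (star y * x) = star y * average x) ?subrr //.
rewrite /average -scalerAr; congr (_ *: _); rewrite mulr_sumr; apply: eq_big_seq => l ls.
by rewrite !mulrA ysA //; apply: qb_in hs _ ls.
Qed.

Let qq_scale x : isqrt_tau%:C%C *: (isqrt_tau%:C%C *: (tau%:C%C *: x)) = x.
Proof. by rewrite !scalerA -!rmorphM (_ : _ * _ = 1) ?rmorph1 ?scale1r // -isqrt_tauP; ring. Qed.

(** The scalar tau^(-n), the square of the factor tau^(-n/2) carried by the quasi-basis of E_n. *)
Definition qsq n : R[i] := (isqrt_tau ^+ n * isqrt_tau ^+ n)%:C%C.

Lemma qsqS n x : qsq n.+1 *: (tau%:C%C *: x) = qsq n *: x.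
Proof.
rewrite /qsq -[in RHS](qq_scale x) !scalerA -!rmorphM; congr (_%:C%C *: _).
by rewrite !exprS; ring.
Qed.

Lemma fourier_coef n : tau `^ (- (n.+2%:R / 2)) = isqrt_tau ^+ n.+2.
Proof.
rewrite powRN mulrC powRrM powR12_sqrt ?(ltW (tw_tau_gt0 T)) //.
by rewrite powR_mulrn ?sqrtr_ge0 // -exprVn.
Qed.

Lemma coef_cancel n x : (isqrt_tau ^+ n.+1)%:C%C *: ((isqrt_tau ^+ n.+1)%:C%C *:
  (tau%:C%C *: ((tau ^+ n)%:C%C *: x))) = x.
Proof.
rewrite !scalerA -!rmorphM (_ : _ * _ = (isqrt_tau * isqrt_tau * tau) ^+ n.+1).
  by rewrite isqrt_tauP expr1n rmorph1 scale1r.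
by rewrite !exprMn -!mulrA -exprS.
Qed.

(** * Fourier transform and rotation *)

Section Rotate.
Variable EE : nat -> M -> M.
Hypothesis hEE : forall k, tr_preserving_cond_exp T k (EE k).
Variable n : nat.

Definition inverse_fourier w : M := (isqrt_tau ^+ n.+2)%:C%C *: E n.+1 (w * star (v n.+1)).

Lemma v_commutant m : rel_commutant B (level m.+1) (v m).
Proof. by split; [exact: v_level | exact: v_commB]. Qed.

Lemma commB_widen m x : rel_commutant B (level m) x -> rel_commutant B (level m.+1) x.
Proof. by move=> [Lx xB]; split=> //; apply: level_sub. Qed.

Lemma fourierE x : rel_commutant B (level n.+1) x ->
  fourier T EE n x = (isqrt_tau ^+ n.+2)%:C%C *: average (x * v n.+1).
Proof.
move=> Nx; rewrite /fourier fourier_coef (average_unique (hEE n.+1)) //.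
by apply: (@subalgM _ _ _ (commB_subalg _)); [exact: commB_widen | exact: v_commutant].
Qed.

Lemma fourier_commA x : rel_commutant B (level n.+1) x ->
  rel_commutant A (level n.+2) (fourier T EE n x).
Proof.
move=> Nx; rewrite fourierE //; apply: subalgZ => //; apply: average_commA.
by apply: (@subalgM _ _ _ (commB_subalg _)); [exact: commB_widen | exact: v_commutant].
Qed.

(** The innermost layer is e_1 a e_1 = E_0(a) e_1. Each further layer commutes with E_0(a) and
    contributes tau through the Jones relation e_(k+1) e_k e_(k+1) = tau e_(k+1). *)
Lemma v_sandwich m a : A a ->
  v m.+1 * a * star (v m.+1) = (tau ^+ m)%:C%C *: (E 0 a * e m.+1).
Proof.
move=> Aa; have La : level 1 a by apply: A_level.
have BEa : B (E 0 a) by apply: (@E_in 0).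
elim: m => [|m IH].
  by rewrite /= mulr1 e_star e_sandwich // expr0 rmorph1 scale1r.
transitivity (e m.+2 * (v m.+1 * a * star (v m.+1)) * e m.+2).
  by rewrite [v m.+2]/= starM e_star !mulrA.
rewrite IH -scalerAr -scalerAl.
rewrite mulrA (@e_comm m.+1 0) // -!mulrA [e m.+2 * _]mulrA.
have L1 : level m.+1 1 by apply: subalg1.
rewrite e_sandwich; last exact: e_level.
rewrite -[e m.+1]mul1r -[1 * e m.+1]mulr1 E_dual // mulr1 -scalerAl mul1r.
by rewrite -scalerAr scalerA -rmorphM -exprSr.
Qed.

(** By [v_sandwich] each summand reduces to a power of tau times l x E_0 (star l). The coefficient
    lies in B and passes x, and the sum of l E_0 (star l) is the expansion of 1. *)
Lemma inverse_fourierK x : rel_commutant B (level n.+1) x ->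
  inverse_fourier (fourier T EE n x) = x.
Proof.
move=> Nx; have [Lx xB] := Nx; rewrite fourierE // /inverse_fourier /average.
have hE := level_exp n.+1; have Lv := v_level n.+1.
have Lx2 := level_sub Lx.
have Lls l : l \in s -> level n.+2 (l * (x * v n.+1) * star l).
  by move=> ls; have := basis_level n.+1 ls; have := basis_star_level n.+1 ls; mem.
have Lsum : level n.+2 (\sum_(l <- s) l * (x * v n.+1) * star l * star (v n.+1)).
  by apply: subalg_sum => // l ls; have := Lls l ls; mem.
rewrite -!scalerAl mulr_suml (ceZ hE); last by mem.
rewrite (ceZ hE) //.
rewrite (ce_sum (level_subalg _) hE); last by move=> l ls; have := Lls l ls; mem.
have E0 l : l \in s -> E n.+1 (l * (x * v n.+1) * star l * star (v n.+1)) =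
    (tau ^+ n.+1)%:C%C *: (l * E 0 (star l) * x).
  move=> ls; have Ll := basis_level n ls; have Als : A (star l).
    by apply: subalg_star => //; apply: qb_in hs _ ls.
  have BE : B (E 0 (star l)) by apply: (@E_in 0); apply: basis_star_level.
  have LE := B_level n.+1 BE; have L1 : level n.+1 1 by apply: subalg1.
  have -> : l * (x * v n.+1) * star l * star (v n.+1) =
      l * x * (v n.+1 * star l * star (v n.+1)).
    by move: (v n.+1) => V; rewrite !mulrA.
  rewrite v_sandwich // -!scalerAr (ceZ hE); last first.
    by have := e_level n; have := level_sub Ll; have := level_sub LE; mem.
  rewrite !mulrA -[_ * e n.+1]mulr1 E_dual ?mulr1 //; last by mem.
  by rewrite scalerA -rmorphM -exprSr -!mulrA xB.
rewrite (eq_big_seq _ E0) -scaler_sumr -mulr_suml.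
have -> : \sum_(l <- s) l * E 0 (star l) = 1.
  rewrite [RHS](qb_left hs (subalg1 hA)).
  by apply: eq_bigr => l _; rewrite mulr1.
rewrite mul1r; apply: coef_cancel.
Qed.

Lemma inverse_fourier_commB w : rel_commutant A (level n.+2) w ->
  rel_commutant B (level n.+1) (inverse_fourier w).
Proof.
move=> /commA_commB Nw; apply: subalgZ => //; apply: E_commB.
apply: (@subalgM _ _ _ (commB_subalg _)) => //.
apply: (@subalg_star _ _ _ (commB_subalg _)); exact: v_commutant.
Qed.

(** Since w commutes with A, the letter l moves inside the expectation to the right of w; the result
    is the quasi-basis expansion of w for E_(n+1). *)
Lemma fourierK w : rel_commutant A (level n.+2) w ->
  fourier T EE n (inverse_fourier w) = w.
Proof.
move=> Nw; have [Lw wA] := Nw; rewrite fourierE; last exact: inverse_fourier_commB.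
have hE := level_exp n.+1; have Lv := v_level n.+1.
rewrite /inverse_fourier /average -scalerAl.
transitivity ((isqrt_tau ^+ n.+2)%:C%C *: ((isqrt_tau ^+ n.+2)%:C%C *: (tau%:C%C *:
    \sum_(l <- s) E n.+1 (w * l * star (v n.+1)) * v n.+1 * star l))).
  rewrite [RHS]scalerA [in RHS]mulrC -[RHS]scalerA; congr (_ *: _).
  rewrite [in RHS]scalerA [in RHS]mulrC -[in RHS]scalerA; congr (_ *: _).
  rewrite scaler_sumr; apply: eq_big_seq => l ls.
  have Ll := basis_level n ls; have Ll2 := level_sub Ll.
  rewrite -!scalerAr -!scalerAl; congr (_ *: _).
  rewrite mulrA -(ceMl (level_subalg _) hE) //; last by mem.
  by rewrite mulrA wA //; apply: qb_in hs _ ls.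
rewrite [RHS](qb_v_right Lw) !scalerA -!rmorphM; congr (_%:C%C *: _).
by rewrite !exprS -[RHS]mulr1 -isqrt_tauP; ring.
Qed.

(** [fourier_inv] chooses some preimage: [fourierK] shows that one exists and [inverse_fourierK]
    that it is unique. *)
Lemma fourier_invE w : rel_commutant A (level n.+2) w ->
  fourier_inv T EE n w = inverse_fourier w.
Proof.
move=> Nw; rewrite /fourier_inv.
pose P := [set x | rcB T n x /\ fourier T EE n x = w].
have Pw : P (inverse_fourier w).
  by split; [exact: inverse_fourier_commB | exact: fourierK].
have [Ny yw] : P (xget 0 P) by apply: xgetI Pw.
by rewrite -[LHS]inverse_fourierK // yw.
Qed.

Lemma rotation_commB x : rel_commutant B (level n.+1) x ->
  rel_commutant B (level n.+1) (rotation T EE n x).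
Proof.
move=> Nx; have NF := fourier_commA Nx.
have NFs : rel_commutant A (level n.+2) (star (fourier T EE n x)) by apply: subalg_star.
by rewrite /rotation fourier_invE //; apply: subalg_star => //; apply: inverse_fourier_commB.
Qed.

(** In v_(n+1) l x v_(n+1) the two copies of e_(n+1) enclose v_n l x, which lies in A_n; they
    collapse to E_n(v_n l x) e_(n+1), and the outer E_(n+1) turns the remaining projection into
    tau. *)
Lemma rotationE x : rel_commutant B (level n.+1) x -> rotation T EE n x =
  \sum_(l <- s) qsq n *: E n (v n * l * x) * v n * star l.
Proof.
move=> Nx; have NF := fourier_commA Nx; have [LF _] := NF; have [Lx _] := Nx.
have NFs : rel_commutant A (level n.+2) (star (fourier T EE n x)) by apply: subalg_star.
have hE := level_exp n.+1; have Lv := v_level n.+1; have Lvn := v_level n.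
have Lx2 := level_sub Lx.
rewrite /rotation fourier_invE // /inverse_fourier star_real.
have LFvs : level n.+2 (star (fourier T EE n x) * star (v n.+1)).
  by case: NFs => LFs _; apply: subalgM => //; apply: subalg_star.
rewrite -(ce_star (level_subalg _) hE) // starM !starK.
rewrite fourierE // /average -!scalerAr mulr_sumr.
have Ls l : l \in s -> level n.+2 (v n.+1 * (l * (x * v n.+1) * star l)).
  by move=> ls; have := basis_level n.+1 ls; have := basis_star_level n.+1 ls; mem.
have Lsum : level n.+2 (\sum_(l <- s) v n.+1 * (l * (x * v n.+1) * star l)).
  exact: subalg_sum.
rewrite !(ceZ hE) //; try by mem.
rewrite (ce_sum (level_subalg _) hE) // !scaler_sumr.
apply: eq_big_seq => l ls; have Ll := basis_level n ls; have Lls := basis_star_level n ls.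
have Lvx : level n.+1 (v n * l * x) by mem.
have LE : level n.+1 (E n (v n * l * x)) by apply/level_sub/E_in.
have -> : v n.+1 * (l * (x * v n.+1) * star l) =
    E n (v n * l * x) * e n.+1 * (v n * star l).
  rewrite -e_sandwich // [v n.+1]/=; move: (v n) => V.
  by rewrite !mulrA.
rewrite E_dual //; last by mem.
rewrite -[in RHS]scalerAl -[in RHS]scalerAl -[in RHS]mulrA.
by rewrite -2![RHS]qsqS /qsq !scalerA -!rmorphM; congr (_%:C%C *: _); ring.
Qed.

End Rotate.

(** * Iterates of the rotation *)

(** A rotation is the sum over l of the lowering map [rot_out n l] followed by the raising map
    [rot_in n (star l)]. The quasi-basis expansion has the same raising maps, with [basis_coord n l]
    as lowering map. *)
Definition rot_out n l x : M := qsq n *: E n (v n * l * x).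
Definition rot_in n m x : M := x * v n * m.
Definition basis_coord n l x : M := qsq n *: E n (x * l * star (v n)).

(* outs and ins read a word from its last letter to its first, coords from its
   first to its last. *)
Fixpoint ins j (ms : seq M) x : M :=
  if ms is m :: ms' then rot_in (j + size ms') m (ins j ms' x) else x.
Fixpoint outs j (ls : seq M) x : M :=
  if ls is l :: ls' then rot_out j l (outs j.+1 ls' x) else x.
Fixpoint coords (ls : seq M) x : M :=
  if ls is l :: ls' then coords ls' (basis_coord (size ls') l x) else x.

Fixpoint words k : seq (seq M) :=
  if k is k'.+1 then [seq l :: ls | l <- s, ls <- words k'] else [:: [::]].

Lemma wordsP k ls : ls \in words k -> size ls = k /\ {subset ls <= s}.
Proof.
elim: k ls => [|k IH] ls /=; first by rewrite inE => /eqP ->.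
move=> /allpairsP[[l ls'] /= [sl /IH[sz sub] ->]]; split; first by rewrite /= sz.
by move=> m; rewrite in_cons => /orP[/eqP -> //|/sub].
Qed.

Lemma rot_out_level n l x : level 1 l -> level n.+1 x -> level n (rot_out n l x).
Proof.
move=> L1 Lx; have Ll : level n.+1 l by apply: level_mono L1.
by have Lv := v_level n; apply: subalgZ => //; apply: E_in; mem.
Qed.

Lemma rot_in_level n m x : level 1 m -> level n x -> level n.+1 (rot_in n m x).
Proof.
move=> L1 Lx; have Lm : level n.+1 m by apply: level_mono L1.
by have Lx1 := level_sub Lx; have Lv := v_level n; rewrite /rot_in; mem.
Qed.

Lemma basis_coord_level n l x : level 1 l -> level n.+1 x -> level n (basis_coord n l x).
Proof.
move=> L1 Lx; have Ll : level n.+1 l by apply: level_mono L1.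
have Lvs := subalg_star (level_subalg n.+1) (v_level n).
by apply: subalgZ => //; apply: E_in; mem.
Qed.

Lemma rot_out_sum n l (I : eqType) (r : seq I) (F : I -> M) : level 1 l ->
  (forall i, i \in r -> level n.+1 (F i)) ->
  rot_out n l (\sum_(i <- r) F i) = \sum_(i <- r) rot_out n l (F i).
Proof.
move=> L1 LF; have Ll : level n.+1 l by apply: level_mono L1.
have Lv := v_level n.
rewrite /rot_out mulr_sumr (ce_sum (level_subalg _) (level_exp n)).
  by rewrite scaler_sumr.
by move=> i ir; have := LF i ir; mem.
Qed.

Lemma rot_in_sum n m (I : Type) (r : seq I) (F : I -> M) :
  rot_in n m (\sum_(i <- r) F i) = \sum_(i <- r) rot_in n m (F i).
Proof. by rewrite /rot_in !mulr_suml. Qed.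

(* This lets all the rot_out of an iterate be performed before all the rot_in. *)
Lemma rot_out_in n l m x : level 1 l -> level 1 m -> level n.+1 x ->
  rot_out n.+1 l (rot_in n.+1 m x) = rot_in n m (rot_out n l x).
Proof.
move=> Ll1 Lm1 Lx; have Ll : level n.+1 l by apply: level_mono Ll1.
have Lm : level n.+1 m by apply: level_mono Lm1.
have Lv := v_level n; have Lvx : level n.+1 (v n * l * x) by mem.
have LE : level n.+1 (E n (v n * l * x)) by apply/level_sub/E_in.
rewrite /rot_out /rot_in.
have -> : v n.+1 * l * (x * v n.+1 * m) = E n (v n * l * x) * e n.+1 * (v n * m).
  by rewrite -e_sandwich // [v n.+1]/=; move: (v n) => V; rewrite !mulrA.
by rewrite E_dual ?qsqS ?scalerAl ?mulrA //; mem.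
Qed.

Lemma ins_level j ms x : (forall m, m \in ms -> level 1 m) -> level j x ->
  level (j + size ms) (ins j ms x).
Proof.
move=> L1 Lx; elim: ms L1 => [|m ms IH] L1 /=; first by rewrite addn0.
rewrite addnS; apply: rot_in_level; first by apply: L1; rewrite mem_head.
by apply: IH => i im; apply: L1; rewrite in_cons im orbT.
Qed.

Lemma rot_out_ins j l ms x : level 1 l -> (forall m, m \in ms -> level 1 m) ->
  level j.+1 x -> rot_out (j + size ms) l (ins j.+1 ms x) = ins j ms (rot_out j l x).
Proof.
move=> Ll L1 Lx; elim: ms L1 => [|m ms IH] L1 /=; first by rewrite addn0.
have L1' i : i \in ms -> level 1 i by move=> im; apply: L1; rewrite in_cons im orbT.
rewrite addnS addSn rot_out_in ?IH //; first by apply: L1; rewrite mem_head.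
exact: ins_level.
Qed.

Lemma outs_level j ls x : (forall l, l \in ls -> level 1 l) ->
  level (j + size ls) x -> level j (outs j ls x).
Proof.
elim: ls j => [|l ls IH] j L1 /=; first by rewrite addn0.
rewrite addnS -addSn => Lx; apply: rot_out_level; first by apply: L1; rewrite mem_head.
by apply: IH => // i im; apply: L1; rewrite in_cons im orbT.
Qed.

Lemma words_level k ls : ls \in words k -> size ls = k /\
  (forall l, l \in ls -> level 1 l) /\ (forall m, m \in map star ls -> level 1 m).
Proof.
move=> /wordsP[sz sub]; split=> //; split=> [l /sub|m /mapP[l /sub ls' ->]].
  exact: basis_level.
exact: basis_star_level.
Qed.

(** Induction on k: the new lowering map is moved past all raising maps already present, and its
    index drops from n to j on the way. For k = n + 1 the lowered element lies in B. *)
Lemma iter_rot_sum n x k j : level n.+1 x -> (j + k)%N = n.+1 ->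
  iter k (fun y => \sum_(l <- s) rot_in n (star l) (rot_out n l y)) x =
  \sum_(ls <- words k) ins j (map star ls) (outs j ls x).
Proof.
move=> Lx; elim: k j => [|k IH] j jk /=; first by rewrite big_seq1.
rewrite (IH j.+1) ?addSnnS // big_allpairs_dep; apply: eq_big_seq => l ls /=.
have L1 := basis_level 0 ls.
have jn : n = (j + k)%N by move: jk; rewrite addnS => -[].
rewrite rot_out_sum //; last first.
  move=> t /words_level[sz [tL tsL]]; rewrite jn -addSn -sz -(size_map star).
  apply: ins_level => //; apply: outs_level => //.
  by rewrite sz addSn -jn.
rewrite rot_in_sum; apply: eq_big_seq => t /words_level[sz [tL tsL]].
rewrite size_map sz -jn {2}jn -sz -(size_map star) rot_out_ins //.
by apply: outs_level => //; rewrite sz addSn -jn.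
Qed.

Lemma coords_expansion k x : level k x ->
  x = \sum_(ls <- words k) ins 0 (map star ls) (coords ls x).
Proof.
elim: k x => [|k IH] x Lx /=; first by rewrite big_seq1.
rewrite big_allpairs_dep {1}(qb_v_right Lx) scaler_sumr.
apply: eq_big_seq => l ls; have L1 := basis_level 0 ls.
rewrite !scalerAl -/(basis_coord k l x) -/(rot_in k (star l) _).
rewrite {1}(IH _ (basis_coord_level L1 Lx)) rot_in_sum.
apply: eq_big_seq => t /words_level[sz _] /=.
by rewrite add0n size_map sz.
Qed.

Definition qprod j k : R[i] := \prod_(i < k) qsq (j + i).

Lemma qprodSl j k : qprod j k.+1 = qsq j * qprod j.+1 k.
Proof.
rewrite /qprod big_ord_recl addn0; congr (_ * _).
by apply: eq_bigr => i _; rewrite addSnnS.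
Qed.

Lemma qprodSr j k : qprod j k.+1 = qprod j k * qsq (j + k).
Proof. by rewrite /qprod big_ord_recr. Qed.

Fixpoint trs j k x : M := if k is k'.+1 then E j (trs j.+1 k' x) else x.

Lemma trsSr j k x : trs j k.+1 x = trs j k (E (j + k) x).
Proof.
elim: k j => [|k IH] j; first by rewrite addn0.
by rewrite [LHS]/= -/(trs j.+1 k.+1 x) IH addSnnS.
Qed.

Lemma trs_tr n x : trs 0 n.+1 x = tr n x.
Proof. by elim: n x => [|n IH] x //; rewrite trsSr IH. Qed.

Lemma trs_level j k x : level (j + k) x -> level j (trs j k x).
Proof.
elim: k j => [|k IH] j /=; first by rewrite addn0.
by rewrite addnS -addSn => /IH; apply: E_in.
Qed.

Lemma trs_left j k a x : level j a -> level (j + k) x ->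
  trs j k (a * x) = a * trs j k x.
Proof.
elim: k j => [|k IH] j //= La; rewrite addnS -addSn => Lx.
rewrite (IH j.+1) //; last exact: level_sub.
by rewrite (ceMl (level_subalg _) (level_exp j)) //; apply: trs_level.
Qed.

Lemma trsZ j k (c : R[i]) x : level (j + k) x -> trs j k (c *: x) = c *: trs j k x.
Proof.
elim: k j => [|k IH] j //=; rewrite addnS -addSn => Lx.
by rewrite IH // (ceZ (level_exp j)) //; apply: trs_level.
Qed.

(** For letters l_0, ..., l_(k-1), [out_word 0] is v_0 l_0 v_1 l_1 ... v_(k-1) l_(k-1), with
    ascending v. In [coord_word] each l_i is followed by the adjoint of v_(k-1-i), with descending
    index. *)
Fixpoint out_word j ls : M :=
  if ls is l :: ls' then v j * l * out_word j.+1 ls' else 1.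
Fixpoint coord_word ls : M :=
  if ls is l :: ls' then l * star (v (size ls')) * coord_word ls' else 1.

Lemma out_word_level j ls : (forall l, l \in ls -> level 1 l) ->
  level (j + size ls) (out_word j ls).
Proof.
elim: ls j => [|l ls IH] j L1 /=; first exact: subalg1.
have Ll : level 1 l by apply: L1; rewrite mem_head.
have L1' i : i \in ls -> level 1 i by move=> im; apply: L1; rewrite in_cons im orbT.
have LU : level (j + (size ls).+1) (out_word j.+1 ls) by rewrite addnS -addSn; apply: IH.
have Lj : level (j + (size ls).+1) (v j) by apply: level_mono (v_level j); rewrite addnS ltnS leq_addr.
have Ll' : level (j + (size ls).+1) l by apply: level_mono Ll; rewrite addnS.
by mem.
Qed.

Lemma coord_word_level ls : (forall l, l \in ls -> level 1 l) ->
  level (size ls) (coord_word ls).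
Proof.
elim: ls => [|l ls IH] L1 /=; first exact: (subalg1 (level_subalg 0)).
have Ll : level 1 l by apply: L1; rewrite mem_head.
have L1' i : i \in ls -> level 1 i by move=> im; apply: L1; rewrite in_cons im orbT.
have LU := level_sub (IH L1'); have Ll' : level (size ls).+1 l by apply: level_mono Ll.
have Lvs := subalg_star (level_subalg _) (v_level (size ls)).
exact: (subalgM (level_subalg (size ls).+1) (subalgM (level_subalg _) Ll' Lvs) LU).
Qed.

Lemma outsE j ls x : (forall l, l \in ls -> level 1 l) -> level (j + size ls) x ->
  outs j ls x = qprod j (size ls) *: trs j (size ls) (out_word j ls * x).
Proof.
elim: ls j => [|l ls IH] j L1 /=; first by rewrite mul1r /qprod big_ord0 scale1r.
have Ll : level 1 l by apply: L1; rewrite mem_head.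
have L1' i : i \in ls -> level 1 i by move=> im; apply: L1; rewrite in_cons im orbT.
rewrite addnS -addSn => Lx; rewrite IH // /rot_out qprodSl.
have Lvl : level j.+1 (v j * l).
  by apply: subalgM => //; [exact: v_level | apply: level_mono Ll].
have LU := out_word_level j.+1 L1'.
have LUx : level (j.+1 + size ls) (out_word j.+1 ls * x) by apply: subalgM.
rewrite -scalerAr (ceZ (level_exp j)); last by apply: subalgM => //; apply: trs_level.
by rewrite scalerA -trs_left // !mulrA.
Qed.

Lemma coordsE ls x : (forall l, l \in ls -> level 1 l) -> level (size ls) x ->
  coords ls x = qprod 0 (size ls) *: trs 0 (size ls) (x * coord_word ls).
Proof.
elim: ls x => [|l ls IH] x L1; first by rewrite /= mulr1 /qprod big_ord0 scale1r.
have Ll : level 1 l by apply: L1; rewrite mem_head.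
have L1' i : i \in ls -> level 1 i by move=> im; apply: L1; rewrite in_cons im orbT.
move=> Lx; rewrite [LHS]/= IH //; last exact: basis_coord_level.
have LV := coord_word_level L1'; have Ll' : level (size ls).+1 l by apply: level_mono Ll.
have Lvs := subalg_star (level_subalg _) (v_level (size ls)).
have Lxlv : level (size ls).+1 (x * l * star (v (size ls))).
  by apply: (subalgM (level_subalg _)) => //; apply: (subalgM (level_subalg _)).
rewrite [size (l :: ls)]/= trsSr qprodSr add0n -scalerA; congr (_ *: _).
have LEV : level (size ls) (E (size ls) (x * l * star (v (size ls))) * coord_word ls).
  by apply: subalgM => //; apply: E_in.
rewrite /basis_coord -scalerAl trsZ // [coord_word (l :: ls)]/= !mulrA.
by rewrite (ceMr (level_subalg _) (level_exp (size ls)) Lxlv LV).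
Qed.

Fixpoint ascending j k : M := if k is k'.+1 then e j.+1 * ascending j.+1 k' else 1.

Lemma ascendingSr j k : ascending j k.+1 = ascending j k * e (j + k).+1.
Proof.
elim: k j => [|k IH] j; first by rewrite /= mulr1 mul1r addn0.
by rewrite [LHS]/= -/(ascending j.+1 k.+1) IH addSnnS mulrA.
Qed.

Lemma star_v k : star (v k) = ascending 0 k.
Proof.
elim: k => [|k IH]; first exact: star1.
by rewrite ascendingSr -IH add0n [v _]/= starM e_star.
Qed.

Lemma ascending_comm j k x : level j x -> ascending j k * x = x * ascending j k.
Proof.
elim: k j => [|k IH] j Lx /=; first by rewrite mul1r mulr1.
by rewrite -mulrA IH ?mulrA ?(e_comm (leqnn j)) //; apply: level_sub.
Qed.

(** Each v_(i+1) is e_(i+1) v_i. A projection arising further right commutes with every block v_i l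
    to its left, so the extra projections gather in front in ascending order. *)
Lemma out_word_shift j ls : (forall l, l \in ls -> level 1 l) ->
  out_word j.+1 ls = ascending j (size ls) * out_word j ls.
Proof.
elim: ls j => [|l ls IH] j L1 /=; first by rewrite mulr1.
have Ll : level 1 l by apply: L1; rewrite mem_head.
have L1' i : i \in ls -> level 1 i by move=> im; apply: L1; rewrite in_cons im orbT.
have Lvl : level j.+1 (v j * l).
  by apply: subalgM => //; [exact: v_level | apply: level_mono Ll].
rewrite (IH j.+1) // -[e j.+1 * v j * l]mulrA; move: (v j * l) Lvl => V LV.
by rewrite -!mulrA; congr (_ * _); rewrite !mulrA (ascending_comm _ LV).
Qed.

(** Shifting the tail from index 1 to 0 leaves [ascending 0] in front of it, and this is exactly the
    adjoint of v required by [coord_word]. *)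
Lemma out_word_coord ls : (forall l, l \in ls -> level 1 l) ->
  out_word 0 ls = coord_word ls.
Proof.
elim: ls => [|l ls IH] L1 //=.
have L1' i : i \in ls -> level 1 i by move=> im; apply: L1; rewrite in_cons im orbT.
by rewrite mul1r out_word_shift // -star_v IH // mulrA.
Qed.

(** With the words identified, only tr(U x) and tr(x U) remain to be compared; U is merely in A_n,
    and x in B' makes them equal. *)
Lemma outs_coords n ls x : rel_commutant B (level n.+1) x -> ls \in words n.+1 ->
  outs 0 ls x = coords ls x.
Proof.
move=> Nx /words_level[sz [L1 _]]; have [Lx _] := Nx.
rewrite outsE ?coordsE ?sz //; congr (_ *: _).
rewrite !trs_tr out_word_coord // (tr_tracial Nx) //.
by rewrite -sz; apply: coord_word_level.
Qed.

Lemma iter_rotation n EE x : (forall k, tr_preserving_cond_exp T k (EE k)) ->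
  rel_commutant B (level n.+1) x -> iter n.+1 (rotation T EE n) x = x.
Proof.
move=> hEE Nx; have [Lx _] := Nx.
pose P y := \sum_(l <- s) rot_in n (star l) (rot_out n l y).
have iterE k : rel_commutant B (level n.+1) (iter k (rotation T EE n) x) /\
    iter k (rotation T EE n) x = iter k P x.
  elim: k => [|k [IHN IH]] //=; split; first exact: rotation_commB.
  rewrite rotationE // -IH; apply: eq_bigr => l _.
  by rewrite /rot_in /rot_out.
rewrite (iterE n.+1).2 (iter_rot_sum Lx (add0n _)) [RHS](coords_expansion Lx).
by apply: eq_big_seq => ls wls; rewrite (outs_coords Nx wls).
Qed.

End Tower.

Theorem theorem3p7 (R : realType) (M : cstarType R) (B A : set M)
    (hB : cstar_subalg B) (hA : cstar_subalg A) (hBA : B `<=` A)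
    (sB : simple_alg B) (sA : simple_alg A)
    (hE : exists E : M -> M, index_finite_type A B E)
    (T : jones_tower B A)
    (EE : nat -> M -> M) (hEE : forall k, tr_preserving_cond_exp T k (EE k))
    (n : nat) (hn : (1 <= n)%N) (x : M) (hx : rcB T n x) :
  iter n.+1 (rotation T EE n) x = x.
Proof.
(* This quasi-basis witnesses the index of E_0, so the sum of l (star l) is tau^(-1). *)
have [_ [s hs hw] _] := tw_minimal T.
exact: (iter_rotation hA hB hBA sB hs hw hEE).
Qed.
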